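(* Let $\Omega\subset\mathbb C^n$ be any bounded open convex set and $1<q\le\infty$. Then the set of functions $g\in\bigcap_{p<q}\mathcal{O}L^p(\Omega)$ which are totally unbounded in $\Omega$ is dense and $G_\delta$ in $\bigcap_{p<q}\mathcal{O}L^p(\Omega)$.
   Context: For a bounded open $\Omega$ and $p\ge1$, $\mathcal{O}L^p(\Omega)$ is the Banach space of holomorphic $f$ on $\Omega$ with $\|f\|_p=(\int_\Omega|f|^p\,dv)^{1/p}<\infty$. For $1<q\le\infty$, $\bigcap_{p<q}\mathcal{O}L^p(\Omega)$ carries the complete metric $d(f,g)=\sum_j2^{-j}\frac{\|f-g\|_{p_j}}{1+\|f-g\|_{p_j}}$ with $1<p_1<p_2<\dots$, $p_j\to q$; convergence means $\|f_k-f\|_p\to0$ for all $p<q$. A holomorphic $f$ is totally unbounded in $\Omega$ if for every $w\in\partial\Omega$, $\delta>0$ and every connected component $E$ of $B(w,\delta)\cap\Omega$, $\sup_E|f|=\infty$. *)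

(* Defs.v *)
From mathcomp Require Import all_boot all_algebra.
From mathcomp Require Import all_classical all_reals all_analysis.
Import GRing.Theory Num.Theory.
From mathcomp Require Import complex.

Set Implicit Arguments.
Unset Strict Implicit.
Unset Printing Implicit Defensive.

Local Open Scope ring_scope.
Local Open Scope classical_set_scope.

Section Defs.
Variable R : realType.

Definition cabs (z : R[i]) : R := Num.sqrt (Re z ^+ 2 + Im z ^+ 2).

Definition cvec (n : nat) := 'I_n -> R[i].

Variable n : nat.

Definition cnorm (z : cvec n) : R := Num.sqrt (\sum_(j < n) cabs (z j) ^+ 2).

Definition cball (w : cvec n) (d : R) : set (cvec n) :=
  [set z | cnorm (fun j => z j - w j) < d].

Definition copen (A : set (cvec n)) : Prop :=
  forall z, A z -> exists2 r : R, 0 < r & cball z r `<=` A.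

Definition cbounded (A : set (cvec n)) : Prop :=
  exists M : R, forall z, A z -> cnorm z <= M.

Definition cconvex (A : set (cvec n)) : Prop :=
  forall a b, A a -> A b -> forall t : R, 0 <= t -> t <= 1 ->
    A (fun j => Complex (1 - t) 0 * a j + Complex t 0 * b j).

Definition cclosure (A : set (cvec n)) : set (cvec n) :=
  [set w | forall e : R, 0 < e -> exists z, A z /\ cnorm (fun j => z j - w j) < e].

Definition cinterior (A : set (cvec n)) : set (cvec n) :=
  [set w | exists2 r : R, 0 < r & cball w r `<=` A].

Definition cboundary (A : set (cvec n)) : set (cvec n) :=
  [set w | cclosure A w /\ ~ cinterior A w].

Definition cconnected (S : set (cvec n)) : Prop :=
  forall U V : set (cvec n), copen U -> copen V -> S `<=` U `|` V ->
    S `&` U `&` V = set0 -> S `&` U !=set0 -> S `&` V !=set0 -> False.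

Definition ccomponent (A : set (cvec n)) (x : cvec n) : set (cvec n) :=
  [set z | exists S : set (cvec n), [/\ S `<=` A, S x, cconnected S & S z]].

Definition is_ccomponent (A E : set (cvec n)) : Prop :=
  exists x, A x /\ E = ccomponent A x.

Definition holomorphic_on (Om : set (cvec n)) (f : cvec n -> R[i]) : Prop :=
  forall z, Om z -> exists a : 'I_n -> R[i],
    forall e : R, 0 < e -> exists2 d : R, 0 < d &
      forall h : cvec n, cnorm h < d ->
        cabs (f (fun j => z j + h j) - f z - \sum_(j < n) a j * h j) <= e * cnorm h.

(* Lebesgue integral over R^m = R x R^(m-1), as iterated Lebesgue integrals
   (for nonnegative Borel integrands this is the Lebesgue integral on R^m by Tonelli) *)
Fixpoint iter_int (m : nat) (F : seq R -> \bar R) : \bar R :=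
  match m with
  | 0 => F [::]
  | m'.+1 => (\int[@lebesgue_measure R]_x iter_int m' (fun s => F (x :: s)))%E
  end.

Definition cvec_of_seq (s : seq R) : cvec n :=
  fun j => Complex (nth 0 s (2 * j)) (nth 0 s (2 * j + 1)).

Definition vol_int (F : cvec n -> \bar R) : \bar R :=
  iter_int (2 * n) (fun s => F (cvec_of_seq s)).

Definition Lp_int (Om : set (cvec n)) (p : R) (f : cvec n -> R[i]) : \bar R :=
  vol_int (fun z => (\1_Om z * cabs (f z) `^ p)%:E).

Definition in_OLp (Om : set (cvec n)) (p : R) (f : cvec n -> R[i]) : Prop :=
  holomorphic_on Om f /\ (Lp_int Om p f < +oo)%E.

Definition Lp_norm (Om : set (cvec n)) (p : R) (f : cvec n -> R[i]) : R :=
  fine (Lp_int Om p f) `^ p^-1.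

Definition in_OLq_minus (Om : set (cvec n)) (q : \bar R) (f : cvec n -> R[i]) : Prop :=
  forall p : R, 1 <= p -> (p%:E < q)%E -> in_OLp Om p f.

Definition exponent_seq (q : \bar R) (ps : nat -> R) : Prop :=
  [/\ forall j, 1 < ps j, forall j, ps j < ps j.+1 &
      ((fun j => (ps j)%:E) @ \oo --> q)%E].

Definition OL_dist (Om : set (cvec n)) (ps : nat -> R) (f g : cvec n -> R[i]) : R :=
  limn (fun N => \sum_(j < N) (2 ^- j.+1 * (Lp_norm Om (ps j) (fun z => f z - g z)
                 / (1 + Lp_norm Om (ps j) (fun z => f z - g z))))).

Definition totally_unbounded (Om : set (cvec n)) (f : cvec n -> R[i]) : Prop :=
  forall w, cboundary Om w -> forall d : R, 0 < d ->
    forall E, is_ccomponent (cball w d `&` Om) E ->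
      forall M : R, exists z, E z /\ M < cabs (f z).

End Defs.

(* Main.v *)
(* One totally unbounded function [h] lying in every [OL^p] suffices. Density:
   on each of countably many balls generating the topology near the boundary,
   at most one value of [t] makes [f + t h] bounded, so some arbitrarily small
   [t] is good for all balls at once. [G_delta]: the condition "[|g|] exceeds
   [M] somewhere in the ball" is open, because a continuous function that is at
   least [eta] in modulus on a small box has [L^p] norm bounded below; no mean
   value property or completeness is needed.

   By convexity, near each boundary ball there is an affine [u] with [Re u >= 0]
   on [Om] and [|u| <= e] at some point of the ball. The function
   [tau = e / (e + u)] then satisfies [|tau| <= 1] and [Re tau >= 0] on [Om],
   and [Re tau >= 1/2] at that point, while its integral tends to [0] with [e]
   by dominated convergence. With [e_k] decreasing fast enough,
   [h = \sum_k 2^k tau_k] converges to a holomorphic function in all [OL^p],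
   and since the real parts do not cancel, [h] is unbounded near every boundary
   point. *)
Require Import Defs.
From mathcomp Require Import all_boot all_order all_algebra.
From mathcomp Require Import all_classical all_reals all_analysis.
From mathcomp Require Import measurable_realfun.
From mathcomp Require Import lra ring.
Import Order.TTheory GRing.Theory Num.Theory.
Import numFieldNormedType.Exports.
From mathcomp Require Import complex.

Local Open Scope ring_scope.
Local Open Scope classical_set_scope.

Set Implicit Arguments.
Unset Strict Implicit.
Unset Printing Implicit Defensive.

(** * Complex absolute value and norm *)

Section ComplexNorm.
Variable R : realType.
Implicit Types (z w : R[i]).

Lemma cabsE z : ((cabs z)%:C)%C = `|z|.
Proof. by rewrite normc_def. Qed.

Lemma cabs_ge0 z : 0 <= cabs z.
Proof. exact: sqrtr_ge0. Qed.

Lemma cabs0 : cabs (0 : R[i]) = 0.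
Proof. by apply: complexI; rewrite cabsE normr0. Qed.

Lemma cabsM z w : cabs (z * w) = cabs z * cabs w.
Proof. by apply: complexI; rewrite rmorphM /= !cabsE normrM. Qed.

Lemma cabsN z : cabs (- z) = cabs z.
Proof. by apply: complexI; rewrite !cabsE normrN. Qed.

Lemma cabsB z w : cabs (z - w) = cabs (w - z).
Proof. by rewrite -cabsN opprB. Qed.

Lemma cabsV z : cabs z^-1 = (cabs z)^-1.
Proof. by apply: complexI; rewrite fmorphV /= !cabsE normfV. Qed.

Lemma cabsD z w : cabs (z + w) <= cabs z + cabs w.
Proof. by rewrite -lecR rmorphD /= !cabsE ler_normD. Qed.

Lemma cabs_sum (I : Type) (s : seq I) (P : pred I) (F : I -> R[i]) :
  cabs (\sum_(i <- s | P i) F i) <= \sum_(i <- s | P i) cabs (F i).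
Proof.
elim/big_ind2 : _ => [|x1 x2 y1 y2 h1 h2|//]; first by rewrite cabs0.
exact: le_trans (cabsD _ _) (lerD h1 h2).
Qed.

Lemma cabs_sq z : cabs z ^+ 2 = Re z ^+ 2 + Im z ^+ 2.
Proof. by rewrite sqr_sqrtr// addr_ge0 ?sqr_ge0. Qed.

Lemma Re_le_cabs z : `|Re z| <= cabs z.
Proof.
by rewrite -sqrtr_sqr ler_wsqrtr// lerDl sqr_ge0.
Qed.

Lemma Im_le_cabs z : `|Im z| <= cabs z.
Proof.
by rewrite -sqrtr_sqr ler_wsqrtr// lerDr sqr_ge0.
Qed.

Lemma cabs_le_ReIm z : cabs z <= `|Re z| + `|Im z|.
Proof.
rewrite -[leRHS]ger0_norm ?addr_ge0// -sqrtr_sqr ler_wsqrtr//.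
rewrite sqrrD !real_normK ?num_real// lerD2r lerDl.
by rewrite mulrn_wge0// mulr_ge0.
Qed.

Lemma cabs_real (x : R) : cabs (x%:C)%C = `|x|.
Proof. by rewrite /cabs /= expr0n addr0 sqrtr_sqr. Qed.

Lemma ReD z w : Re (z + w) = Re z + Re w.
Proof. by case: z w => [a b] [c d]. Qed.

Lemma ImD z w : Im (z + w) = Im z + Im w.
Proof. by case: z w => [a b] [c d]. Qed.

Lemma ReN z : Re (- z) = - Re z.
Proof. by case: z. Qed.

Lemma ImN z : Im (- z) = - Im z.
Proof. by case: z. Qed.

Lemma ReM z w : Re (z * w) = Re z * Re w - Im z * Im w.
Proof. by case: z w => [a b] [c d]. Qed.

Lemma Re_sum (I : Type) (s : seq I) (P : pred I) (F : I -> R[i]) :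
  Re (\sum_(i <- s | P i) F i) = \sum_(i <- s | P i) Re (F i).
Proof. exact: (big_morph _ ReD). Qed.

Lemma Im_sum (I : Type) (s : seq I) (P : pred I) (F : I -> R[i]) :
  Im (\sum_(i <- s | P i) F i) = \sum_(i <- s | P i) Im (F i).
Proof. exact: (big_morph _ ImD). Qed.

Variable n : nat.
Implicit Types (x y : cvec R n).

Lemma cnorm_ge0 x : 0 <= cnorm x.
Proof. exact: sqrtr_ge0. Qed.

Lemma cnorm_sq x : cnorm x ^+ 2 = \sum_(j < n) cabs (x j) ^+ 2.
Proof. by rewrite sqr_sqrtr// sumr_ge0// => j _; rewrite sqr_ge0. Qed.

Lemma cnormZ (a : R[i]) x : cnorm (fun j => a * x j) = cabs a * cnorm x.
Proof.
rewrite /cnorm -[X in X * _](ger0_norm (cabs_ge0 a)) -sqrtr_sqr -sqrtrM ?sqr_ge0//.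
by rewrite mulr_sumr; under eq_bigr do rewrite cabsM exprMn.
Qed.

Lemma coord_le_cnorm x j : cabs (x j) <= cnorm x.
Proof.
rewrite -[leLHS](ger0_norm (cabs_ge0 _)) -sqrtr_sqr ler_wsqrtr//.
by rewrite (bigD1 j)//= lerDl sumr_ge0// => i _; rewrite sqr_ge0.
Qed.

Lemma cnorm_le_sum x : cnorm x <= \sum_(j < n) cabs (x j).
Proof.
have s0 : 0 <= \sum_(j < n) cabs (x j) by apply: sumr_ge0 => j _; exact: cabs_ge0.
rewrite -(@ler_pXn2r _ 2)// ?nnegrE ?cnorm_ge0// cnorm_sq expr2 mulr_suml.
apply: ler_sum => j _; rewrite expr2 ler_wpM2l ?cabs_ge0//.
by rewrite (bigD1 j)//= lerDl sumr_ge0// => i _; exact: cabs_ge0.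
Qed.

(** The factor is [n.+1] and not [n] so that the inequality stays strict in dimension 0. *)
Lemma cnorm_lt_coord x (e : R) : 0 < e -> (forall j, cabs (x j) < e) ->
  cnorm x < n.+1%:R * e.
Proof.
move=> e0 h; apply: le_lt_trans (cnorm_le_sum x) _.
rewrite -natr1 mulrDl mul1r; apply: (@le_lt_trans _ _ (n%:R * e)); last first.
  by rewrite ltrDl.
rewrite mulr_natl -[n in _ *+ n]card_ord -sumr_const; apply: ler_sum => j _.
exact/ltW.
Qed.

Lemma cnormB x y : cnorm (fun j => x j - y j) = cnorm (fun j => y j - x j).
Proof.
by congr (Num.sqrt _); apply: eq_bigr => j _; rewrite cabsB.
Qed.

(** The difference of the two sides is the squared norm of [x - y] (parallelogram law). This serves
    as a triangle inequality until [cnormD] is derived from the convexity of balls. *)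
Lemma cnorm_sqD x y :
  cnorm (fun j => x j + y j) ^+ 2 <= 2 * cnorm x ^+ 2 + 2 * cnorm y ^+ 2.
Proof.
rewrite !cnorm_sq !mulr_sumr -big_split/=; apply: ler_sum => j _.
rewrite !cabs_sq ReD ImD.
set a := Re (x j); set b := Re (y j); set c := Im _; set d := Im _.
rewrite -subr_ge0 (_ : _ - _ = (a - b) ^+ 2 + (c - d) ^+ 2); last by ring.
by rewrite addr_ge0 ?sqr_ge0.
Qed.

End ComplexNorm.

(** * Iterated integrals of lower semicontinuous functions *)

Section IteratedIntegral.
Variable R : realType.
Implicit Types (m k : nat) (s : seq R) (F G : seq R -> \bar R).
Local Open Scope ereal_scope.
Local Notation mu := (@lebesgue_measure R).

(* Lower semicontinuity is stable under partial integration by Fatou's lemma,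
   so it yields the measurability of all the partial integrals without any
   recourse to product sigma-algebras. *)
Definition slsc m F := forall s, size s = m -> forall c : R, c%:E < F s ->
  exists2 d : R, (0 < d)%R & forall s', size s' = m ->
    (forall i, (i < m)%N -> `|nth 0 s' i - nth 0 s i| < d)%R -> c%:E < F s'.

Lemma iter_int_ge0 m F : (forall s, size s = m -> 0 <= F s) ->
  0 <= iter_int m F.
Proof.
elim: m F => [|m IH] F F0 /=; first exact: F0.
by apply: integral_ge0 => x _; apply: IH => s sm; apply: F0; rewrite /= sm.
Qed.

Lemma eq_iter_int m F G : (forall s, size s = m -> F s = G s) ->
  iter_int m F = iter_int m G.
Proof.
elim: m F G => [|m IH] F G FG /=; first exact: FG.
by apply: eq_integral => x _; apply: IH => s sm; apply: FG; rewrite /= sm.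
Qed.

(** Monotonicity holds for arbitrary nonnegative functions: the integral is a supremum over the
    simple functions below the integrand, and this set grows with the integrand. *)
Lemma ge0_le_integralT (f g : R -> \bar R) : (forall x, 0 <= f x) ->
  (forall x, f x <= g x) -> \int[mu]_x f x <= \int[mu]_x g x.
Proof.
move=> f0 fg.
rewrite !ge0_integralTE//; last by move=> x; exact: le_trans (f0 x) (fg x).
apply: ereal_sup_le => _ [h hf <-]; exists h => // x.
exact: le_trans (hf x) (fg x).
Qed.

Lemma iter_int_le m F G : (forall s, size s = m -> 0 <= F s) ->
  (forall s, size s = m -> F s <= G s) -> iter_int m F <= iter_int m G.
Proof.
elim: m F G => [|m IH] F G F0 FG /=; first exact: FG.
apply: ge0_le_integralT => x.
  by apply: iter_int_ge0 => s sm; apply: F0; rewrite /= sm.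
by apply: IH => s sm; [apply: F0|apply: FG]; rewrite /= sm.
Qed.

Lemma iter_int_eq0 m F : (forall s, size s = m -> F s = 0) -> iter_int m F = 0.
Proof.
elim: m F => [|m IH] F F0 /=; first exact: F0.
rewrite (eq_integral (cst 0)) ?integral0// => x _.
by apply: IH => s sm; apply: F0; rewrite /= sm.
Qed.

Lemma lee_real_lt (a b : \bar R) : 0 <= b ->
  (forall c : R, c%:E < a -> c%:E <= b) -> a <= b.
Proof.
move=> b0 h; rewrite leNgt; apply/negP => ba.
case: b b0 h ba => [b| |] //= _ h ba; last by rewrite ltNge leey in ba.
case: a ba h => [a| |] //= ba h.
  have := h ((a + b) / 2)%R; rewrite !lte_fin !lee_fin in ba *.
  by move=> /(_ ltac:(lra)); lra.
by have := h (b + 1)%R (ltry _); rewrite lee_fin; lra.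
Qed.

Lemma slsc_measurable1 (H : seq R -> \bar R) : slsc 1 H ->
  measurable_fun [set: R] ((fun x => H [:: x]) : R -> \bar R).
Proof.
move=> lH; apply: lower_semicontinuous_measurable => x a aH.
have [d d0 hd] := lH [:: x] erefl a aH.
exists (ball x d); first exact: nbhsx_ballx.
move=> y /= xy; apply: hd => // -[|//] _ /=.
by rewrite distrC.
Qed.

Lemma slsc_rcons k F s : slsc k.+1 F -> size s = k ->
  slsc 1 (fun t => F (s ++ t)).
Proof.
move=> lF sk t t1 c cF.
have [|d d0 hd] := lF (s ++ t) _ c cF; first by rewrite size_cat sk t1 addn1.
exists d => // t' t'1 ht; apply: hd; first by rewrite size_cat sk t'1 addn1.
move=> i ik; rewrite !nth_cat sk; case: ltnP => [_|ki].
  by rewrite subrr normr0.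
by apply: ht; rewrite ltn_subLR// addn1.
Qed.

Lemma slsc_cons m F x : slsc m.+1 F -> slsc m (fun s => F (x :: s)).
Proof.
move=> lF s sm c cF.
have [|d d0 hd] := lF (x :: s) _ c cF; first by rewrite /= sm.
exists d => // s' s'm hs; apply: hd; first by rewrite /= s'm.
by case=> [_|i im] /=; [rewrite subrr normr0|exact: hs].
Qed.

(** If the claim failed at [s], there would be points [u i] tending to [s] whose integrals stay at
    most [c]. Fatou's lemma along this sequence then bounds the integral at [s] by [c], a
    contradiction. *)
Lemma slsc_int k F : (forall s, 0 <= F s) -> slsc k.+1 F ->
  slsc k (fun s => \int[mu]_x F (rcons s x)).
Proof.
move=> F0 lF s sk c cF; apply/not_exists2P => h.
have {h}h (i : nat) : exists s' : seq R, [/\ size s' = k,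
    (forall j, (j < k)%N -> `|nth 0 s' j - nth 0 s j| < i.+1%:R^-1)%R &
    \int[mu]_x F (rcons s' x) <= c%:E].
  have [|/existsNP[s' /not_implyP[sk' /not_implyP[hs /negP]]]] :=
    h (i.+1%:R^-1)%R; first by rewrite /= invr_gt0 ltr0n.
  by rewrite -leNgt => ?; exists s'.
have [u hu] := choice h.
have mF t : size t = k -> measurable_fun [set: R] ((fun x => F (rcons t x)) : R -> \bar R).
  move=> tk; have := slsc_measurable1 (slsc_rcons lF tk).
  by under [X in measurable_fun _ X]eq_fun do rewrite cats1.
have /(_ measurableT) := @fatou _ _ _ mu [set: R] _ (fun i x => F (rcons (u i) x)).
move=> /(_ (fun i => mF _ (let: And3 a _ _ := hu i in a)) (fun _ _ _ => F0 _)).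
move=> fat; have : \int[mu]_x F (rcons s x) <= c%:E; last by rewrite leNgt cF.
apply: le_trans (le_trans fat _); last first.
  rewrite limn_einf_lim; apply: lime_le; first exact: is_cvg_einfs.
  near=> i; have [_ _] := hu i; apply: le_trans.
  by apply: ereal_inf_lbound; exists i => //=.
(* By semicontinuity of [F], the integrand at [s] is at most the lower limit of the integrands at
   the [u i]. *)
apply: ge0_le_integralT => [//|x]; apply: lee_real_lt.
  rewrite limn_einf_lim; apply: lime_ge; first exact: is_cvg_einfs.
  by near=> i; apply: le_ereal_inf_tmp => _ [j _ <-]; exact: F0.
move=> a aF; have [|d d0 hd] := lF (rcons s x) _ a aF.
  by rewrite size_rcons sk.
rewrite limn_einf_lim; apply: lime_ge; first exact: is_cvg_einfs.
near=> i; apply: le_ereal_inf_tmp => _ [j /= ij <-]; apply/ltW.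
have [sj hj _] := hu j; apply: hd; first by rewrite size_rcons sj.
move=> l lk; rewrite !nth_rcons sj sk; case: ltngtP => [lk'|//|_].
- apply: lt_trans (hj _ lk') _; apply: (@le_lt_trans _ _ i.+1%:R^-1)%R.
    by rewrite lef_pV2 ?posrE ?ltr0n// ler_nat.
  near: i; exact: near_infty_natSinv_lt (PosNum d0).
- by rewrite subrr normr0.
- by rewrite subrr normr0.
Unshelve. all: by end_near. Qed.

(** Induction on [m] with [k] free: the first integrated variable is moved to the end of the [k]
    parameters, the induction hypothesis handles the other integrals, and [slsc_int] integrates that
    last parameter. *)
Lemma slsc_iter_int m k F : (forall s, 0 <= F s) -> slsc (k + m) F ->
  slsc k (fun s => iter_int m (fun t => F (s ++ t))).
Proof.
elim: m k F => [|m IH] k F F0 lF.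
  by under eq_fun do rewrite /= cats0; rewrite addn0 in lF.
have /= := IH k.+1 _ F0; rewrite addSnnS => /(_ lF) lH.
have := slsc_int (fun s => iter_int_ge0 (fun t _ => F0 _)) lH.
by under eq_fun => s do under eq_integral => x _ do
  under eq_iter_int => t _ do rewrite cat_rcons.
Qed.

Lemma iter_int_measurable m F : (forall s, 0 <= F s) -> slsc m.+1 F ->
  measurable_fun [set: R]
    ((fun x => iter_int m (fun s => F (x :: s))) : R -> \bar R).
Proof.
move=> F0 lF; have := @slsc_iter_int m 1 F F0; rewrite add1n => /(_ lF).
by move=> /slsc_measurable1.
Qed.

Lemma iter_intD m F G : (forall s, 0 <= F s) -> (forall s, 0 <= G s) ->
  slsc m F -> slsc m G ->
  iter_int m (fun s => F s + G s) = iter_int m F + iter_int m G.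
Proof.
elim: m F G => [//|m IH] F G F0 G0 lF lG /=.
transitivity (\int[mu]_x (iter_int m (fun s => F (x :: s)) +
    iter_int m (fun s => G (x :: s)))).
  by apply: eq_integral => x _; rewrite IH//; exact: slsc_cons.
rewrite ge0_integralD//.
- by move=> x _; exact: iter_int_ge0.
- exact: iter_int_measurable.
- by move=> x _; exact: iter_int_ge0.
- exact: iter_int_measurable.
Qed.

Lemma iter_intZ m F (c : R) : (0 <= c)%R -> (forall s, 0 <= F s) -> slsc m F ->
  iter_int m (fun s => c%:E * F s) = c%:E * iter_int m F.
Proof.
move=> c0; elim: m F => [//|m IH] F F0 lF /=.
transitivity (\int[mu]_x (c%:E * iter_int m (fun s => F (x :: s)))).
  by apply: eq_integral => x _; rewrite IH//; exact: slsc_cons.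
rewrite ge0_integralZl_EFin//.
- by move=> x _; exact: iter_int_ge0.
- exact: iter_int_measurable.
Qed.

Lemma iter_int_nneseries m (F_ : nat -> seq R -> \bar R) :
  (forall i s, 0 <= F_ i s) -> (forall i, slsc m (F_ i)) ->
  iter_int m (fun s => \sum_(i <oo) F_ i s) = \sum_(i <oo) iter_int m (F_ i).
Proof.
elim: m F_ => [//|m IH] F_ F0 lF /=.
transitivity (\int[mu]_x (\sum_(i <oo) iter_int m (fun s => F_ i (x :: s)))).
  apply: eq_integral => x _.
  by rewrite (IH (fun i s => F_ i (x :: s)))// => i; exact: slsc_cons.
rewrite integral_nneseries//.
- by move=> i; exact: iter_int_measurable.
- by move=> i x _; exact: iter_int_ge0.
Qed.

(** The open cube of half-side [d] about [c], by recursion on the coordinates, so that the iterated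
    integral peels it off one factor at a time. *)
Fixpoint inbox (c : seq R) (d : R) s : bool :=
  match c, s with
  | x :: c', y :: s' => (`|y - x| < d)%R && inbox c' d s'
  | _, _ => true
  end.

Lemma inboxP c d s : size s = size c ->
  reflect (forall i, (i < size c)%N -> `|nth 0 s i - nth 0 c i| < d)%R
          (inbox c d s).
Proof.
elim: c s => [|x c IH] [|y s] //= => [_|[sc]]; first by apply: ReflectT.
apply: (iffP andP) => [[h /(IH _ sc) h'] [|i]//|h].
  by rewrite ltnS => /h'.
by split; [exact: (h 0%N)|apply/(IH _ sc) => i ic; exact: (h i.+1)].
Qed.

Lemma integral_ball (x d c : R) : (0 <= d)%R -> (0 <= c)%R ->
  \int[mu]_y (((`|y - x| < d)%R : nat)%:R * c)%:E = (2 * d * c)%:E.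
Proof.
move=> d0 c0; pose A : set R := `](x - d)%R, (x + d)%R[.
have mA : measurable A by exact: measurable_itv.
transitivity (\int[mu]_y (c%:E * (\1_A y)%:E)).
  apply: eq_integral => y _; rewrite -EFinM mulrC; congr ((_ * _%:R)%:E).
  by rewrite /A mem_setE in_itv/= ltr_distl.
rewrite ge0_integralZl_EFin//; last first.
  exact/measurable_EFinP/measurable_indic.
rewrite integral_indic// setIT.
transitivity (c%:E * (2 * d)%:E); last by rewrite -EFinM mulrC.
congr (_ * _); apply: (eq_trans (@lebesgue_measure_itv R (Interval (BRight (x - d)%R) (BLeft (x + d)%R)))).
rewrite /= lte_fin; case: ifPn => [_|]; first by rewrite -EFinB; congr EFin; ring.
by rewrite -leNgt => h; congr EFin; lra.
Qed.

Lemma iter_int_box c d (k : R) : (0 <= d)%R -> (0 <= k)%R ->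
  iter_int (size c) (fun s => ((inbox c d s : nat)%:R * k)%:E) =
  ((2 * d) ^+ size c * k)%:E.
Proof.
move=> d0 k0; elim: c => [//|x c IH] /=.
rewrite exprS -mulrA -(@integral_ball x d)//; last first.
  by rewrite mulr_ge0// exprn_ge0// mulr_ge0.
apply: eq_integral => y _; case: (ltP _ d) => h /=.
  by rewrite IH mul1r.
by rewrite mul0r iter_int_eq0 ?mul0r// => s _; rewrite mul0r.
Qed.

(** Dominated convergence, one variable at a time. The inner integrals tend to 0 by induction; they
    vanish when the outer variable leaves its interval and are otherwise at most the volume of the
    remaining cube. *)
Lemma iter_int_dominated (F_ : nat -> seq R -> \bar R) c d : (0 <= d)%R ->
  (forall i s, 0 <= F_ i s) -> (forall i, slsc (size c) (F_ i)) ->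
  (forall i s, size s = size c -> F_ i s <= (inbox c d s : nat)%:R%:E) ->
  (forall s, size s = size c -> F_ ^~ s @ \oo --> 0) ->
  (fun i => iter_int (size c) (F_ i)) @ \oo --> 0.
Proof.
move=> d0; elim: c F_ => [|x c IH] F_ F0 lF Fb Fc /=; first exact: Fc.
have [|||||_ _] := @dominated_convergence _ _ _ mu [set: R] measurableT
  (fun i y => iter_int (size c) (fun s => F_ i (y :: s))) (cst 0)
  (fun y => (((`|y - x| < d)%R : nat)%:R * ((2 * d) ^+ size c))%:E).
- by move=> i; exact: iter_int_measurable.
- exact: measurable_cst.
- apply/aeW => y _; apply: IH => //.
  + by move=> i; exact: slsc_cons.
  + move=> i s sc; apply: le_trans (Fb i (y :: s) _) _; first by rewrite /= sc.
    by rewrite lee_fin ler_nat /=; case: (_ < _)%R.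
  + by move=> s sc; apply: Fc; rewrite /= sc.
- apply/integrableP; split.
    apply/measurable_EFinP; apply: measurable_funM => //.
    pose A : set R := `](x - d)%R, (x + d)%R[.
    apply: (eq_measurable_fun (\1_A : R -> R)) => [y _|].
      by rewrite /= indicE /A mem_setE in_itv/= ltr_distl.
    by apply: measurable_indic; exact: measurable_itv.
  have c0 : (0 <= (2 * d) ^+ size c)%R by rewrite exprn_ge0 ?mulr_ge0.
  rewrite (_ : integral _ _ _ = (2 * d * (2 * d) ^+ size c)%:E) ?ltry//.
  rewrite -(@integral_ball x d)//; apply: eq_integral => y _.
  by rewrite gee0_abs// lee_fin mulr_ge0.
- apply/aeW => y i _; rewrite gee0_abs ?iter_int_ge0//.
  case: (ltP _ d) => yd /=.
    rewrite -[X in _ <= (_ * X)%:E]mulr1 mul1r -iter_int_box//.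
    apply: iter_int_le => // s sc; rewrite mulr1.
    by have := Fb i (y :: s); rewrite /= yd => -> //; rewrite sc.
  rewrite mul0r iter_int_eq0// => s sc; apply/eqP; rewrite eq_le F0 andbT.
  by have := Fb i (y :: s); rewrite /= ltNge yd /= => -> //; rewrite sc.
- by rewrite integral0; apply.
Qed.

End IteratedIntegral.

(** * Integrals over an open set *)

Section DomainIntegral.
Variables (R : realType) (n : nat) (Om : set (cvec R n)).
Hypothesis Om_open : copen Om.
Implicit Types (z : cvec R n) (g : cvec R n -> R) (f : cvec R n -> R[i]).

Local Notation cvs := (@cvec_of_seq R n).

Definition dom_int g : \bar R := vol_int (fun z => (\1_Om z * g z)%:E).

Definition lsc_on g := forall z, Om z -> forall c, c < g z ->
  exists2 d, 0 < d & forall z', Om z' -> cnorm (fun j => z' j - z j) < d -> c < g z'.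

Definition ccontinuous_on f := forall z, Om z -> forall e, 0 < e ->
  exists2 d, 0 < d &
    forall h, cnorm h < d -> cabs (f (fun j => z j + h j) - f z) < e.

Lemma cnorm_cvec_of_seq (s s' : seq R) (d : R) : 0 < d ->
  (forall i, (i < 2 * n)%N -> `|nth 0 s' i - nth 0 s i| < d) ->
  cnorm (fun j => cvs s' j - cvs s j) < n.+1%:R * (2 * d).
Proof.
move=> d0 h; apply: cnorm_lt_coord => [|j]; first by rewrite mulr_gt0.
apply: le_lt_trans (cabs_le_ReIm _) _; rewrite mulr_natl mulr2n /=.
apply: ltrD; apply: h; have := ltn_ord j; first by rewrite ltn_pmul2l.
by rewrite addn1 !mul2n ltn_Sdouble.
Qed.

(** Real and imaginary parts are interleaved as [cvec_of_seq] expects; for indices below [2 * n] the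
    default 0 is never reached. *)
Definition seq_of_cvec z : seq R :=
  mkseq (fun i => if insub i./2 is Some j then
                    if odd i then Im (z j) else Re (z j) else 0) (2 * n).

Lemma seq_of_cvecK z : cvs (seq_of_cvec z) = z.
Proof.
apply/funext => j; rewrite /cvec_of_seq /seq_of_cvec.
have hj := ltn_ord j.
have j1 : (2 * j < 2 * n)%N by rewrite ltn_pmul2l.
have j2 : (2 * j + 1 < 2 * n)%N by rewrite addn1 !mul2n ltn_Sdouble.
rewrite !nth_mkseq// mul2n addn1 /= odd_double /= uphalf_double doubleK valK.
by case: (z j).
Qed.

Lemma dom_fun_ge0 g : (forall z, Om z -> 0 <= g z) ->
  forall z, 0 <= \1_Om z * g z.
Proof.
move=> g0 z; rewrite indicE; case: (boolP (z \in Om)) => zO.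
  by rewrite mul1r g0//; rewrite inE in zO.
by rewrite mul0r.
Qed.

(** Inside [Om], openness keeps nearby points inside, so the semicontinuity of [g] suffices.
    Outside, the value is 0, and nonnegativity keeps all nearby values above any negative [c]. *)
Lemma slsc_dom_fun g : (forall z, Om z -> 0 <= g z) -> lsc_on g ->
  slsc (2 * n) (fun s => (\1_Om (cvs s) * g (cvs s))%:E).
Proof.
move=> g0 lg s sn c; rewrite lte_fin indicE.
case: (boolP (cvs s \in Om)) => zO /=; last first.
  rewrite mul0r => c0; exists 1 => // s' _ _; rewrite lte_fin.
  exact: lt_le_trans c0 (dom_fun_ge0 g0 _).
rewrite mul1r => cg; rewrite inE in zO.
have [d d0 hd] := lg _ zO _ cg.
have [r r0 hr] := Om_open zO.
have m0 : 0 < Num.min d r by rewrite lt_min d0.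
exists (Num.min d r / (n.+1%:R * 2)); first by rewrite divr_gt0// mulr_gt0.
move=> s' _ hs.
have {hs} := cnorm_cvec_of_seq _ hs; rewrite divr_gt0// ?mulr_gt0// => /(_ isT).
rewrite mulrA mulrC divfK ?gt_eqF ?mulr_gt0// lt_min => /andP[h1 h2].
have zO' := hr _ h2; rewrite lte_fin indicE mem_set// mul1r.
exact: hd.
Qed.

Lemma dom_int_ge0 g : (forall z, Om z -> 0 <= g z) -> (0 <= dom_int g)%E.
Proof.
by move=> g0; apply: iter_int_ge0 => s _; rewrite lee_fin dom_fun_ge0.
Qed.

Lemma eq_dom_int g g' : (forall z, Om z -> g z = g' z) -> dom_int g = dom_int g'.
Proof.
move=> gg; apply: eq_iter_int => s _; rewrite indicE.
by case: (boolP (_ \in Om)) => zO; rewrite ?mul0r// gg//; rewrite inE in zO.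
Qed.

Lemma dom_int_le g g' : (forall z, Om z -> 0 <= g z) ->
  (forall z, Om z -> g z <= g' z) -> (dom_int g <= dom_int g')%E.
Proof.
move=> g0 gg; apply: iter_int_le => s _; rewrite lee_fin ?dom_fun_ge0//.
rewrite indicE; case: (boolP (_ \in Om)) => zO; rewrite ?mul0r// !mul1r gg//.
by rewrite inE in zO.
Qed.

Lemma dom_intD g g' : (forall z, Om z -> 0 <= g z) ->
  (forall z, Om z -> 0 <= g' z) -> lsc_on g -> lsc_on g' ->
  dom_int (fun z => g z + g' z) = (dom_int g + dom_int g')%E.
Proof.
move=> g0 g0' lg lg'; rewrite /dom_int /vol_int -iter_intD.
- by apply: eq_iter_int => s _; rewrite mulrDr EFinD.
- by move=> s; rewrite lee_fin dom_fun_ge0.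
- by move=> s; rewrite lee_fin dom_fun_ge0.
- exact: slsc_dom_fun.
- exact: slsc_dom_fun.
Qed.

Lemma dom_intZ g (c : R) : 0 <= c -> (forall z, Om z -> 0 <= g z) -> lsc_on g ->
  dom_int (fun z => c * g z) = (c%:E * dom_int g)%E.
Proof.
move=> c0 g0 lg; rewrite /dom_int /vol_int -iter_intZ//.
- by apply: eq_iter_int => s _; rewrite mulrCA EFinM.
- by move=> s; rewrite lee_fin dom_fun_ge0.
- exact: slsc_dom_fun.
Qed.

Lemma dom_int_le_nneseries g (g_ : nat -> cvec R n -> R) :
  (forall z, Om z -> 0 <= g z) -> (forall i z, Om z -> 0 <= g_ i z) ->
  (forall i, lsc_on (g_ i)) ->
  (forall z, Om z -> (g z)%:E <= \sum_(i <oo) (g_ i z)%:E)%E ->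
  (dom_int g <= \sum_(i <oo) dom_int (g_ i))%E.
Proof.
move=> g0 g0' lg gg; rewrite /dom_int /vol_int -iter_int_nneseries.
- apply: iter_int_le => s _; first by rewrite lee_fin dom_fun_ge0.
  have [zO|zO] := pselect (Om (cvs s)).
    rewrite indicE mem_set// mul1r; apply: le_trans (gg _ zO) _.
    by under [leRHS]eq_eseriesr do rewrite mul1r.
  rewrite indicE memNset// mul0r; apply: nneseries_ge0 => i _ _.
  by rewrite lee_fin mul0r.
- by move=> i s; rewrite lee_fin dom_fun_ge0// => z; exact: g0'.
- by move=> i; apply: slsc_dom_fun => // z; exact: g0'.
Qed.

(** The ball of radius [r] contains a cube of half-side [r / (2 (n + 1))] about its centre; [v] is
    the volume of that cube and depends on [r] only. *)
Lemma dom_int_ball (r : R) : 0 < r -> exists2 v : R, 0 < v &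
  forall z g (c : R), cball z r `<=` Om -> 0 <= c ->
    (forall y, Om y -> 0 <= g y) -> (forall y, cball z r y -> c <= g y) ->
    ((v * c)%:E <= dom_int g)%E.
Proof.
move=> r0; pose d := r / (n.+1%:R * 2).
have d0 : 0 < d by rewrite divr_gt0// mulr_gt0.
exists ((2 * d) ^+ (2 * n)); first by rewrite exprn_gt0// mulr_gt0.
move=> z g c zO c0 g0 gc.
have sz : size (seq_of_cvec z) = (2 * n)%N by rewrite size_mkseq.
rewrite -{1}sz -iter_int_box ?(ltW d0)// sz; apply: iter_int_le => s sn.
  by rewrite lee_fin mulr_ge0.
rewrite lee_fin; case: inboxP => [|h|_]; first by rewrite sn sz.
  have yb : cball z r (cvs s).
    rewrite sz in h; have := cnorm_cvec_of_seq d0 h.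
    by rewrite seq_of_cvecK mulrA mulrC divfK// gt_eqF// mulr_gt0.
  by rewrite mul1r indicE mem_set ?mul1r ?gc//; exact: zO.
by rewrite mul0r dom_fun_ge0.
Qed.

(** A bounded [Om] lies in the cube of half-side [|M| + 1] about the origin, where
    [iter_int_dominated] applies. *)
Lemma dom_int_dominated (g_ : nat -> cvec R n -> R) : cbounded Om ->
  (forall i z, Om z -> 0 <= g_ i z) -> (forall i z, Om z -> g_ i z <= 1) ->
  (forall i, lsc_on (g_ i)) ->
  (forall z, Om z -> (fun i => g_ i z) @ \oo --> (0 : R)) ->
  (fun i => dom_int (g_ i)) @ \oo --> (0 : \bar R)%E.
Proof.
move=> [M hM] g0 g1 lg gc.
have := @iter_int_dominated R (fun i s => (\1_Om (cvs s) * g_ i (cvs s))%:E)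
  (nseq (2 * n) 0) (`|M| + 1); rewrite size_nseq; apply.
- by rewrite addr_ge0.
- by move=> i s; rewrite lee_fin dom_fun_ge0// => z; exact: g0.
- by move=> i; apply: slsc_dom_fun => // z; exact: g0.
- move=> i s sn; rewrite lee_fin indicE.
  case: (boolP (_ \in Om)) => zO; last by rewrite mul0r.
  rewrite inE in zO; rewrite mul1r; case: inboxP => [|_|]; first by rewrite size_nseq.
    exact: g1.
  case=> k; rewrite size_nseq nth_nseq => kn; rewrite kn subr0.
  have k2 : (k./2 < n)%N by rewrite ltn_half_double -mul2n.
  have /(le_trans (coord_le_cnorm _ (Ordinal k2))) := hM _ zO.
  rewrite /cvec_of_seq /= => h.
  apply: (@le_lt_trans _ _ M); last by rewrite (le_lt_trans (ler_norm M))// ltrDl.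
  have kE := odd_double_half k; case: (odd k) kE => kE.
    apply: le_trans h; apply: le_trans (Im_le_cabs _) => /=.
    by rewrite -[in leLHS]kE mul2n addnC.
  apply: le_trans h; apply: le_trans (Re_le_cabs _) => /=.
  by rewrite -[in leLHS]kE mul2n add0n.
- move=> s sn; rewrite indicE.
  have [zO|zO] := pselect (Om (cvs s)).
    rewrite mem_set//; under eq_fun do rewrite mul1r.
    by apply: cvg_EFin; [exact: nearW|exact: gc].
  by rewrite memNset//; under eq_fun do rewrite mul0r; exact: cvg_cst.
Qed.

Lemma lsc_onZ g (c : R) : 0 < c -> lsc_on g -> lsc_on (fun z => c * g z).
Proof.
move=> c0 lg z zO a; rewrite -ltr_pdivrMl// => h.
have [d d0 hd] := lg z zO _ h; exists d => // z' zO' hz.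
by rewrite -ltr_pdivrMl//; exact: hd.
Qed.

(** For [c >= 0] the condition [c < |f|^p] amounts to [c^(1/p) < |f|], which persists nearby by
    continuity; for [c < 0] it always holds. *)
Lemma lsc_on_pow f (p : R) : 0 < p -> ccontinuous_on f ->
  lsc_on (fun z => cabs (f z) `^ p).
Proof.
move=> p0 cf z zO c; case: (ltP c 0) => c0 hc.
  by exists 1 => // z' _ _; exact: lt_le_trans c0 (powR_ge0 _ _).
have cz : c `^ p^-1 < cabs (f z).
  rewrite ltNge; apply/negP => h; move: hc; rewrite ltNge => /negP; apply.
  have := ge0_ler_powR (ltW p0) _ _ h; rewrite !nnegrE powR_ge0 cabs_ge0.
  by move=> /(_ isT isT) /le_trans; apply; rewrite -powRrM mulVf ?gt_eqF// powRr1.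
have [d d0 hd] := cf z zO (cabs (f z) - c `^ p^-1) ltac:(by rewrite subr_gt0).
exists d => // z' zO' hz.
have {hd} := hd _ hz; rewrite (_ : (fun j => _) = z'); last first.
  by apply/funext => j; rewrite addrCA subrr addr0.
move=> h; have h2 : c `^ p^-1 < cabs (f z').
  have := cabsD (f z') (f z - f z'); rewrite addrCA subrr addr0 [cabs (f z - _)]cabsB.
  lra.
have := @gt0_ltr_powR _ p p0 _ _ _ _ h2; rewrite !nnegrE powR_ge0 cabs_ge0.
by move=> /(_ isT isT); rewrite -powRrM mulVf ?gt_eqF// powRr1.
Qed.

End DomainIntegral.

(** * Convexity and approximate supporting hyperplanes *)

Section Convexity.
Variables (R : realType) (n : nat).
Implicit Types (S Om : set (cvec R n)) (x y z w : cvec R n).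
Local Open Scope complex_scope.

(** The squared norm is convex: [(1-t)|a|^2 + t|b|^2 - |(1-t)a + tb|^2 = t(1-t)|a-b|^2]. *)
Lemma cball_convex w (d : R) : cconvex (cball w d).
Proof.
move=> x y; rewrite /cball /= => xd yd t t0 t1.
have d0 : 0 < d by exact: le_lt_trans (cnorm_ge0 _) xd.
rewrite -(@ltr_pXn2r _ 2)// ?nnegrE ?cnorm_ge0 ?(ltW d0)//.
have {}xd : cnorm (fun j => x j - w j) ^+ 2 < d ^+ 2.
  by rewrite ltr_pXn2r// ?nnegrE ?cnorm_ge0 ?(ltW d0).
have {}yd : cnorm (fun j => y j - w j) ^+ 2 < d ^+ 2.
  by rewrite ltr_pXn2r// ?nnegrE ?cnorm_ge0 ?(ltW d0).
apply: (@le_lt_trans _ _ ((1 - t) * cnorm (fun j => x j - w j) ^+ 2 +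
                          t * cnorm (fun j => y j - w j) ^+ 2)).
  rewrite !cnorm_sq !mulr_sumr -big_split/=; apply: ler_sum => j _.
  rewrite !cabs_sq; case: (x j) (y j) (w j) => [x1 x2] [y1 y2] [w1 w2] /=.
  rewrite -subr_ge0 (_ : _ - _ = t * (1 - t) * ((x1 - y1) ^+ 2 + (x2 - y2) ^+ 2)).
    by rewrite !mulr_ge0 ?subr_ge0 ?addr_ge0 ?sqr_ge0.
  by ring.
set X := _ ^+ 2 in xd *; set Y := _ ^+ 2 in yd *.
have [XY|YX] := leP X Y; [apply: le_lt_trans yd|apply: le_lt_trans xd]; nra.
Qed.

Lemma convexI S1 S2 : cconvex S1 -> cconvex S2 -> cconvex (S1 `&` S2).
Proof.
by move=> c1 c2 a b [a1 a2] [b1 b2] t t0 t1; split; [exact: c1|exact: c2].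
Qed.

Lemma open_segment S a b : copen S ->
  open [set t : R | S (fun j => Complex (1 - t) 0 * a j + Complex t 0 * b j)].
Proof.
move=> oS; rewrite openE => t /= tS; have [r r0 hr] := oS _ tS.
pose D := cnorm (fun j => b j - a j) + 1.
have D0 : 0 < D by rewrite ltr_wpDl// cnorm_ge0.
exists (r / D) => /=; first by rewrite divr_gt0.
move=> u /= tu; apply: hr; rewrite /cball /=.
rewrite (_ : (fun j => _) = (fun j => (u - t)%:C * (b j - a j))).
  rewrite cnormZ cabs_real distrC; apply: (@le_lt_trans _ _ (`|t - u| * D)).
    by rewrite ler_wpM2l// lerDl.
  by rewrite -ltr_pdivlMr.
apply/funext => j; case: (a j) (b j) => [a1 a2] [b1 b2].
by apply/eqP; rewrite eq_complex /=; apply/andP; split; apply/eqP; ring.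
Qed.

Lemma convex_connected S : cconvex S -> cconnected S.
Proof.
move=> cS U V oU oV SUV UV [a [aS aU]] [b [bS bV]].
pose g t j := Complex (1 - t) 0 * a j + Complex t 0 * b j.
have gS t : 0 <= t <= 1 -> S (g t) by move=> /andP[t0 t1]; exact: cS.
have g0 : g 0 = a.
  apply/funext => j; rewrite /g; case: (a j) (b j) => [a1 a2] [b1 b2].
  by apply/eqP; rewrite eq_complex /=; apply/andP; split; apply/eqP; ring.
have g1 : g 1 = b.
  apply/funext => j; rewrite /g; case: (a j) (b j) => [a1 a2] [b1 b2].
  by apply/eqP; rewrite eq_complex /=; apply/andP; split; apply/eqP; ring.
have UVF t : 0 <= t <= 1 -> U (g t) -> V (g t) -> False.
  by move=> t01 tU tV; have : set0 (g t) by rewrite -UV; split => //; split => //; exact: gS.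
have conn : connected (`[0, 1]%classic : set R) by exact: segment_connected.
(* The parameters whose point lies in [U] form a nonempty clopen subset of the unit interval, hence
   all of it; so the end point [b] lies in both [U] and [V]. *)
suff /seteqP[_ /(_ 1)] : `[0, 1]%classic `&` [set t | U (g t)] = `[0, 1]%classic.
  rewrite /= in_itv/= lexx ler01 => /(_ isT)[_].
  rewrite g1 => bU; apply: (UVF 1); rewrite ?g1//; by rewrite ler01 lexx.
apply: conn.
- by exists 0; split; rewrite /= ?in_itv/= ?lexx ?ler01// g0.
- by exists [set t | U (g t)] => //; exact: open_segment.
- exists (~` [set t | V (g t)]); first exact/open_closedC/open_segment.
  apply/seteqP; split => t /= [] /[dup] t01; rewrite in_itv/= => h1 h2; split => //.
    by move=> tV; exact: UVF tV.
  by case: (SUV _ (gS _ h1)).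
Qed.

Lemma ccomponent_sub S x : ccomponent S x `<=` S.
Proof. by move=> z [T [TS _ _]]; exact: TS. Qed.

Lemma ccomponent_convex S x : cconvex S -> S x -> ccomponent S x = S.
Proof.
move=> cS Sx; apply/seteqP; split; first exact: ccomponent_sub.
by move=> z Sz; exists S; split => //; exact: convex_connected.
Qed.

(** The intersection of a ball with a convex set is convex, hence connected, so it is its own only
    component. *)
Lemma totally_unboundedP Om f : cconvex Om ->
  totally_unbounded Om f <->
  (forall w, cboundary Om w -> forall d : R, 0 < d -> forall M : R,
     exists z, [/\ Om z, cball w d z & M < cabs (f z)]).
Proof.
move=> cOm; split => [h w bw d d0 M|h w bw d d0 E [x [Ax ->]] M]; last first.
  have [z [zO zd hz]] := h w bw d d0 M; exists z; split => //.
  by rewrite ccomponent_convex//; exact: convexI (@cball_convex _ _) cOm.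
have [x [xO xd]] := bw.1 d d0.
have [|z [/ccomponent_sub[zd zO] hz]] :=
  h w bw d d0 (ccomponent (cball w d `&` Om) x) _ M; first by exists x.
by exists z.
Qed.

Lemma boundary_not_in Om w : copen Om -> cboundary Om w -> ~ Om w.
Proof. by move=> oO [_ h] /oO[r r0 hr]; apply: h; exists r. Qed.

Lemma rat_approx (x e : R) : 0 < e -> exists q : rat, `|x - ratr q| < e.
Proof.
move=> e0; have [|q] := @rat_in_itvoo R (x - e) (x + e); first by lra.
by rewrite in_itv/= => /andP[h1 h2]; exists q; rewrite ltr_distlC; lra.
Qed.

(** Rational grid points paired with mesh sizes are countable; each pair gets a boundary point near
    its grid point if there is one, and some other boundary point if not. The index [k] can be taken
    arbitrarily large because lower bounds growing with [k] are later attached to the balls. *)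
Lemma boundary_base Om w0 : cboundary Om w0 ->
  exists W : nat -> cvec R n, exists r : nat -> R,
    (forall k, cboundary Om (W k) /\ 0 < r k) /\
    forall w d N, cboundary Om w -> 0 < d ->
      exists2 k, (N <= k)%N & cball (W k) (r k) `<=` cball w d.
Proof.
move=> bw0; pose I := ({ffun 'I_n -> rat * rat} * nat)%type.
pose near_ (i : I) w := cboundary Om w /\ forall j,
  `|Re (w j) - ratr (i.1 j).1| < i.2.+1%:R^-1 /\
  `|Im (w j) - ratr (i.1 j).2| < i.2.+1%:R^-1.
have /choice[W hW] (i : I) : exists w, cboundary Om w /\
    ((exists w', near_ i w') -> near_ i w).
  have [[w h]|h] := pselect (exists w, near_ i w); last by exists w0.
  by exists w; split => //; exact: h.1.
(* The pair is decoded from the exponent of 2 in [k], so the odd part of [k] is free and every pair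
   occurs infinitely often. *)
pose e k : I := odflt ([ffun=> (0, 0)], 0%N) (unpickle (logn 2 k)).
exists (fun k => W (e k)), (fun k => (e k).2.+1%:R^-1); split.
  by move=> k; split; [exact: (hW _).1|rewrite invr_gt0].
move=> w d N bw d0.
(* From [z] to [W], to the grid point, to [w]: three errors of size [h] for the real part and three
   for the imaginary part, hence the factor 6. *)
have [m] := @ltr_add_invr R 0 (d / (n.+1%:R * 6)) ltac:(by rewrite divr_gt0// mulr_gt0).
rewrite add0r => hm; set h := m.+1%:R^-1 in hm.
have h0 : 0 < h by rewrite invr_gt0.
have /choice[q1 hq1] (j : 'I_n) := rat_approx (Re (w j)) h0.
have /choice[q2 hq2] (j : 'I_n) := rat_approx (Im (w j)) h0.
pose i : I := ([ffun j => (q1 j, q2 j)], m).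
(* The factor [3 ^ N] pushes the index beyond [N] and leaves the exponent of 2 unchanged. *)
exists (2 ^ pickle i * 3 ^ N)%N.
  apply: leq_trans (ltnW (ltn_expl N (isT : 1 < 3)%N)) _.
  by rewrite leq_pmull// expn_gt0.
have -> : e (2 ^ pickle i * 3 ^ N)%N = i.
  rewrite /e lognM ?expn_gt0// pfactorK// (@logn_coprime 2 (3 ^ N)) ?coprimeXr//.
  by rewrite addn0 pickleK.
have [_ /(_ (ex_intro _ w _))[|_ hWi]] := hW i.
  by split => // j; rewrite ffunE.
move=> z /= zW; rewrite /cball /=.
apply: lt_le_trans (_ : n.+1%:R * (6 * h) <= d); last first.
  by rewrite mulrA mulrC -ler_pdivlMr ?mulr_gt0//; exact: ltW.
apply: cnorm_lt_coord => [|j]; first by rewrite mulr_gt0.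
have := le_lt_trans (coord_le_cnorm _ j) zW; rewrite /= => zj.
have := le_lt_trans (Re_le_cabs _) zj; have := le_lt_trans (Im_le_cabs _) zj.
have [] := hWi j; have := hq1 j; have := hq2 j; rewrite !ffunE /=.
rewrite -/h !ReD !ImD !ReN !ImN => a1 a2 a3 a4 a5 a6.
apply: le_lt_trans (cabs_le_ReIm _) _; rewrite ReD ImD ReN ImN.
have -> : 6 * h = (h + h + h) + (h + h + h) by ring.
rewrite !ltr_norml in a1 a2 a3 a4 a5 a6; rewrite ltrD// ltr_norml; lra.
Qed.

Definition rdot x y : R := \sum_(j < n) (Re (x j) * Re (y j) + Im (x j) * Im (y j)).

Lemma cnorm_sqDZ x y (s : R) :
  cnorm (fun j => x j + s%:C * y j) ^+ 2 =
  cnorm x ^+ 2 + 2 * s * rdot x y + s ^+ 2 * cnorm y ^+ 2.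
Proof.
rewrite !cnorm_sq !mulr_sumr -!big_split/=; apply: eq_bigr => j _.
by rewrite !cabs_sq; case: (x j) (y j) => [x1 x2] [y1 y2] /=; ring.
Qed.

(** The real functional [rdot x] is the real part of a complex linear form; this turns a real
    hyperplane into a holomorphic affine function. *)
Lemma sum_conjM x y (c : R) :
  Re (\sum_(j < n) c%:C * (x j)^* * y j) = c * rdot x y.
Proof.
rewrite Re_sum mulr_sumr; apply: eq_bigr => j _.
by case: (x j) (y j) => [x1 x2] [y1 y2] /=; ring.
Qed.

Lemma sum_conjZ x (c t : R) :
  \sum_(j < n) c%:C * (x j)^* * (t%:C * x j) = (c * t * cnorm x ^+ 2)%:C.
Proof.
rewrite cnorm_sq mulr_sumr rmorph_sum; apply: eq_bigr => j _.
rewrite cabs_sq; case: (x j) => [x1 x2].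
by apply/eqP; rewrite eq_complex /=; apply/andP; split; apply/eqP; ring.
Qed.

Lemma cnorm_conj x : cnorm (fun j => (x j)^*) = cnorm x.
Proof.
congr (Num.sqrt _); apply: eq_bigr => j _.
by rewrite !cabs_sq; case: (x j) => [a b] /=; rewrite sqrrN.
Qed.

(* The ball around [z] of radius [rho] is the largest one inside [Om]; a point
   [w'] outside [Om] at distance almost [rho] from [z] defines an almost
   supporting hyperplane, orthogonal to [w' - z], since any [y] in [Om] far
   beyond it would put [w'] in the convex hull of [y] and the ball. *)
Lemma support_approx Om w (d k : R) :
  copen Om -> cbounded Om -> cconvex Om -> cboundary Om w -> 0 < d -> 0 < k ->
  exists a : cvec R n, exists b : R[i],
    [/\ cnorm a = 1, forall y, Om y -> 0 <= Re (\sum_(j < n) a j * y j + b) &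
      exists y, [/\ Om y, cball w d y & cabs (\sum_(j < n) a j * y j + b) <= k]].
Proof.
move=> oO [M bO] cO bw d0 k0.
have [z [zO zw]] := bw.1 (d / 2) ltac:(lra).
have wO := boundary_not_in oO bw.
pose E := [set r : R | 0 < r /\ cball z r `<=` Om].
have ubE : ubound E (cnorm (fun j => z j - w j)).
  move=> r [r0 hr]; rewrite leNgt; apply/negP => h; apply: wO; apply: hr.
  by rewrite /cball /= cnormB.
have [r1 r10 hr1] := oO _ zO.
have supE : has_sup E.
  by split; [exists r1|exists (cnorm (fun j => z j - w j))].
set rho := sup E.
have rho0 : 0 < rho by exact: lt_le_trans r10 (ub_le_sup supE.2 (conj r10 hr1)).
have rhod : rho < d / 2 by exact: le_lt_trans (ge_sup supE.1 ubE) zw.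
have inb x : cnorm (fun j => x j - z j) < rho -> Om x.
  move=> xr; have [|r [_ hr] h] := @sup_adherent _ E (rho - cnorm (fun j => x j - z j)) _ supE.
    by rewrite subr_gt0.
  by apply: hr; move: h; rewrite -/rho opprB addrCA subrr addr0.
have outb r : rho < r -> exists x, ~ Om x /\ cnorm (fun j => x j - z j) < r.
  move=> h; apply: contrapT => /forallNP hx; move: h; rewrite ltNge => /negP; apply.
  have [r0|r0] := leP r 0; first exact: le_trans r0 (ltW rho0).
  apply: (ub_le_sup supE.2); split => // x xr; apply: contrapT => xO.
  by apply: (hx x).
(* [D] bounds the squared distance from [w'] to every point of [Om]; [e] is then chosen so that the
   error [e * (1 + D)] is at most [k * rho]. *)
pose D := 4 * rho ^+ 2 + 4 * cnorm z ^+ 2 + 4 * M ^+ 2.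
have D0 : 0 <= D by rewrite !addr_ge0// mulr_ge0// sqr_ge0.
pose e := Num.min rho (Num.min (k * rho / (1 + D)) (k / 4)).
have e0 : 0 < e by rewrite !lt_min rho0 !divr_gt0 ?mulr_gt0// ltr_pwDl.
have er : e <= rho by rewrite ge_min lexx.
have ek : e <= k / 4 by rewrite !ge_min lexx !orbT.
have eD : e * (1 + D) <= k * rho.
  by rewrite -ler_pdivlMr ?ltr_pwDl// !ge_min lexx !orbT.
have [w' [w'O w'z]] : exists x, ~ Om x /\ cnorm (fun j => x j - z j) ^+ 2 < rho ^+ 2 + e ^+ 2.
  have [|x [xO hx]] := outb (Num.sqrt (rho ^+ 2 + e ^+ 2)).
    rewrite -(ltr_pXn2r (isT : 0 < 2)%N) ?nnegrE ?sqrtr_ge0 ?(ltW rho0)//.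
    by rewrite sqr_sqrtr ?addr_ge0 ?sqr_ge0// ltrDl exprn_gt0.
  exists x; split => //; rewrite -(sqr_sqrtr (_ : 0 <= rho ^+ 2 + e ^+ 2)) ?addr_ge0 ?sqr_ge0//.
  by rewrite ltr_pXn2r// ?nnegrE ?sqrtr_ge0 ?cnorm_ge0.
set v : cvec R n := fun j => w' j - z j in w'z.
have vr : rho <= cnorm v by rewrite leNgt; apply/negP => /inb.
have v0 : 0 < cnorm v by exact: lt_le_trans vr.
have vre : cnorm v <= rho + e.
  rewrite -(ler_pXn2r (isT : 0 < 2)%N) ?nnegrE ?addr_ge0 ?cnorm_ge0 ?ltW//.
  by nra.
(* Prolong the segment from [y] to [w'] slightly beyond [w']. The new point is outside [Om], since
   otherwise convexity would put [w'] inside; so it is at distance at least [rho] from [z], and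
   expanding the square gives the bound. *)
have key y : Om y -> - (e * (1 + D)) <= 2 * rdot v (fun j => w' j - y j).
  move=> yO; set u : cvec R n := fun j => w' j - y j.
  have xO : ~ Om (fun j => w' j + e%:C * u j).
    move=> xO; apply: w'O.
    have e1 : 0 < 1 + e by rewrite addr_gt0.
    have i0 : 0 <= (1 + e)^-1 by rewrite invr_ge0 ltW.
    have i1 : (1 + e)^-1 <= 1 by rewrite invf_le1// lerDl ltW.
    have := cO _ _ yO xO _ i0 i1; congr (Om _); apply/funext => j; rewrite /u.
    case: (w' j) (y j) => [x1 x2] [y1 y2].
    by apply/eqP; rewrite eq_complex /=; apply/andP; split; apply/eqP; field; rewrite gt_eqF.
  have : rho ^+ 2 <= cnorm (fun j => v j + e%:C * u j) ^+ 2.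
    rewrite ler_pXn2r ?nnegrE ?cnorm_ge0 ?(ltW rho0)//.
    rewrite leNgt; apply/negP => h; apply: xO; apply: inb; move: h.
    by congr (cnorm _ < _); apply/funext => j; rewrite /v addrAC.
  rewrite cnorm_sqDZ => h.
  have uD : cnorm u ^+ 2 <= D.
    have -> : u = fun j => v j + (z j - y j).
      by apply/funext => j; rewrite /u /v addrA subrK.
    apply: le_trans (cnorm_sqD _ _) _.
    have := cnorm_sqD z (fun j => - y j).
    have -> : cnorm (fun j => - y j) = cnorm y.
      by congr (Num.sqrt _); apply: eq_bigr => j _; rewrite cabsN.
    have : cnorm y ^+ 2 <= M ^+ 2.
      have yM := bO _ yO; rewrite ler_pXn2r ?nnegrE ?cnorm_ge0//.
      exact: le_trans (cnorm_ge0 _) yM.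
    have : e ^+ 2 <= rho ^+ 2 by rewrite ler_pXn2r ?nnegrE ?(ltW e0) ?(ltW rho0).
    rewrite /D; lra.
  have : 0 <= e * (2 * rdot v u + e * (1 + D)) by nra.
  by rewrite pmulr_rge0//; lra.
have [c cE] : exists c, c = - (cnorm v)^-1 by exists (- (cnorm v)^-1).
(* The real part of this affine function is [rdot v (w' - y) / |v| + k / 2]; the shift [k / 2]
   absorbs the error allowed by [key]. *)
exists (fun j => c%:C * (v j)^*), ((k / 2)%:C - \sum_(j < n) c%:C * (v j)^* * w' j).
have LE y : \sum_(j < n) c%:C * (v j)^* * y j +
    ((k / 2)%:C - \sum_(j < n) c%:C * (v j)^* * w' j) =
    \sum_(j < n) (- c)%:C * (v j)^* * (w' j - y j) + (k / 2)%:C.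
  rewrite addrCA addrC; congr (_ + _); rewrite -sumrB; apply: eq_bigr => j _.
  by rewrite rmorphN /=; ring.
split.
- by rewrite cnormZ cabs_real cnorm_conj cE normrN gtr0_norm ?invr_gt0// mulVf ?gt_eqF.
- move=> y yO; rewrite LE ReD sum_conjM cE opprK /=.
  rewrite -(pmulr_rge0 _ v0) mulrDr mulrA divff ?gt_eqF// mul1r.
  have := key y yO; have : k * rho <= k * cnorm v by rewrite ler_pM2l.
  by set t := rdot _ _; lra.
(* The point at distance [rho - e] from [z] in the direction of [w']: there the affine function
   equals [|v| - (rho - e) + k / 2], at most [2 e + k / 2 <= k]. *)
- pose th := (rho - e) / cnorm v.
  have nth_ : cnorm (fun j => th%:C * v j) = rho - e.
    rewrite cnormZ cabs_real ger0_norm ?divfK ?gt_eqF//.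
    by rewrite divr_ge0 ?subr_ge0// ltW.
  exists (fun j => z j + th%:C * v j); split.
  + apply: inb; rewrite (_ : (fun j => _) = (fun j => th%:C * v j)) ?nth_.
      by rewrite ltrBlDr ltrDl.
    by apply/funext => j; rewrite addrAC subrr add0r.
  + rewrite /cball /= -(ltr_pXn2r (isT : 0 < 2)%N) ?nnegrE ?cnorm_ge0 ?(ltW d0)//.
    rewrite (_ : (fun j => _) = (fun j => th%:C * v j + (z j - w j))); last first.
      by apply/funext => j; ring.
    apply: le_lt_trans (cnorm_sqD _ _) _; rewrite nth_.
    have : cnorm (fun j => z j - w j) ^+ 2 < (d / 2) ^+ 2.
      by rewrite ltr_pXn2r ?nnegrE ?cnorm_ge0//; lra.
    have : (rho - e) ^+ 2 < (d / 2) ^+ 2.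
      by rewrite ltr_pXn2r ?nnegrE//; lra.
    by rewrite (_ : d ^+ 2 = 2 * (d / 2) ^+ 2 + 2 * (d / 2) ^+ 2); [lra|field].
  + rewrite LE (eq_bigr (fun j => (- c)%:C * (v j)^* * ((1 - th)%:C * v j))); last first.
      by move=> j _; congr (_ * _); rewrite rmorphB /= /v; ring.
    rewrite sum_conjZ -rmorphD /= cabs_real cE opprK.
    have -> : (cnorm v)^-1 * (1 - th) * cnorm v ^+ 2 = cnorm v - (rho - e).
      by rewrite /th; field; rewrite gt_eqF.
    by rewrite ger0_norm; lra.
Qed.

End Convexity.

(** * The function space and its metric *)

Section FunctionSpace.
Variables (R : realType) (n : nat) (Om : set (cvec R n)).
Hypothesis Om_open : copen Om.
Implicit Types (z w : cvec R n) (f g h : cvec R n -> R[i]).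
Local Open Scope complex_scope.

(** The gauge argument: scale [x] and [y] into the unit ball and use its convexity. The scales
    exceed the norms by [e / 2], which keeps them positive for zero vectors. *)
Lemma cnormD (x y : cvec R n) : cnorm (fun j => x j + y j) <= cnorm x + cnorm y.
Proof.
apply/ler_addgt0Pr => e e0.
set a := cnorm x + e / 2; set b := cnorm y + e / 2.
have a0 : 0 < a by rewrite ltr_wpDl ?cnorm_ge0 ?divr_gt0.
have b0 : 0 < b by rewrite ltr_wpDl ?cnorm_ge0 ?divr_gt0.
have ab0 : 0 < a + b by rewrite addr_gt0.
have unit_ball (u : cvec R n) c : cnorm u < c ->
    cball (fun _ => 0) 1 (fun j => (c^-1)%:C * u j).
  move=> uc; have c0 := le_lt_trans (cnorm_ge0 u) uc.
  rewrite /cball /= (_ : (fun j => _) = (fun j => (c^-1)%:C * u j)).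
    by rewrite cnormZ cabs_real gtr0_norm ?invr_gt0// mulrC ltr_pdivrMr// mul1r.
  by apply/funext => j; rewrite subr0.
have /unit_ball ux : cnorm x < a by rewrite /a ltrDl divr_gt0.
have /unit_ball uy : cnorm y < b by rewrite /b ltrDl divr_gt0.
have t0 : 0 <= b / (a + b) by rewrite divr_ge0 ?ltW.
have t1 : b / (a + b) <= 1 by rewrite ler_pdivrMr// mul1r lerDr ltW.
have := cball_convex ux uy t0 t1; rewrite /cball /=.
rewrite (_ : (fun j => _) = (fun j => ((a + b)^-1)%:C * (x j + y j))).
  rewrite cnormZ cabs_real gtr0_norm ?invr_gt0// mulrC ltr_pdivrMr// mul1r.
  by move=> /ltW /le_trans; apply; rewrite /a /b; lra.
apply/funext => j; case: (x j) (y j) => [x1 x2] [y1 y2].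
apply/eqP; rewrite eq_complex /=; apply/andP; split; apply/eqP; field;
  by rewrite ?gt_eqF.
Qed.

Lemma cball_open w (d : R) : copen (cball w d).
Proof.
move=> z zd; exists (d - cnorm (fun j => z j - w j)); first by rewrite subr_gt0.
move=> y /=; rewrite /cball /= ltrBrDr => h; apply: le_lt_trans h.
apply: le_trans (cnormD _ _); rewrite le_eqVlt; apply/orP; left; apply/eqP.
by congr cnorm; apply/funext => j; rewrite addrA subrK.
Qed.

Lemma cabs_lin (a x : cvec R n) :
  cabs (\sum_(j < n) a j * x j) <= (\sum_(j < n) cabs (a j)) * cnorm x.
Proof.
apply: le_trans (cabs_sum _ _ _) _; rewrite mulr_suml; apply: ler_sum => j _.
by rewrite cabsM ler_wpM2l ?cabs_ge0// coord_le_cnorm.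
Qed.

Lemma holomorphic_continuous f : holomorphic_on Om f -> ccontinuous_on Om f.
Proof.
move=> hf z zO e e0; have [a ha] := hf z zO; have [d d0 hd] := ha 1 ltr01.
set A := \sum_(j < n) cabs (a j).
have A0 : 0 < 1 + A.
  by rewrite ltr_pwDl// sumr_ge0// => j _; exact: cabs_ge0.
exists (Num.min d (e / (1 + A))); first by rewrite lt_min d0 divr_gt0.
move=> x; rewrite lt_min => /andP[xd]; rewrite ltr_pdivlMr// => xe.
have := hd _ xd; rewrite mul1r => h1.
have := cabsD (f (fun j => z j + x j) - f z - \sum_(j < n) a j * x j)
  (\sum_(j < n) a j * x j); rewrite subrK.
have := cabs_lin a x; rewrite -/A; lra.
Qed.

Lemma holomorphic_lin f g (c : R[i]) : holomorphic_on Om f -> holomorphic_on Om g ->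
  holomorphic_on Om (fun z => f z + c * g z).
Proof.
move=> hf hg z zO; have [a ha] := hf z zO; have [b hb] := hg z zO.
exists (fun j => a j + c * b j) => e e0.
have c0 : 0 < 2 * (1 + cabs c) by rewrite mulr_gt0// ltr_pwDl// cabs_ge0.
have [d d0 hd] := ha (e / 2) ltac:(by rewrite divr_gt0).
have [d' d0' hd'] := hb (e / (2 * (1 + cabs c))) ltac:(by rewrite divr_gt0).
exists (Num.min d d'); first by rewrite lt_min d0.
move=> x; rewrite lt_min => /andP[/hd h1 /hd' h2].
rewrite (_ : \sum_(j < n) _ = \sum_(j < n) a j * x j + c * \sum_(j < n) b j * x j).
  set y := (fun j => z j + x j) in h1 h2 *.
  set s1 := \sum_(j < n) _ in h1 *; set s2 := \sum_(j < n) _ in h2 *.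
  rewrite (_ : _ - _ - _ = (f y - f z - s1) + c * (g y - g z - s2)); last by ring.
  apply: le_trans (cabsD _ _) _; rewrite cabsM.
  have h3 : cabs c * cabs (g y - g z - s2) <= e / 2 * cnorm x.
    apply: le_trans (ler_wpM2l (cabs_ge0 c) h2) _.
    rewrite mulrA ler_wpM2r ?cnorm_ge0// mulrCA ler_wpM2l ?(ltW e0)//.
    rewrite invfM mulrCA ler_piMr ?invr_ge0// ler_pdivrMr ?ltr_pwDl ?cabs_ge0//.
    by rewrite mul1r lerDr.
  lra.
by rewrite mulr_sumr -big_split/=; apply: eq_bigr => j _; ring.
Qed.

(** The sum is at most twice the larger term; this makes [L^p] closed under linear combinations. *)
Lemma powR_add_le (a b p : R) : 0 <= a -> 0 <= b -> 0 < p ->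
  (a + b) `^ p <= 2 `^ p * (a `^ p + b `^ p).
Proof.
move=> a0 b0 p0; wlog ab : a b a0 b0 / a <= b.
  move=> H; have [|/ltW] := leP a b; first exact: H.
  by rewrite addrC [a `^ p + _]addrC; exact: H.
apply: (@le_trans _ _ ((2 * b) `^ p)).
  by rewrite ge0_ler_powR ?nnegrE ?addr_ge0 ?mulr_ge0 ?(ltW p0)//; lra.
by rewrite powRM// ler_wpM2l ?powR_ge0// lerDr powR_ge0.
Qed.

Lemma Lp_intE p f : Lp_int Om p f = dom_int Om (fun z => cabs (f z) `^ p).
Proof. by []. Qed.

Lemma Lp_int_ge0 p f : (0 <= Lp_int Om p f)%E.
Proof. by rewrite Lp_intE; apply: dom_int_ge0 => z _; exact: powR_ge0. Qed.

Lemma Lp_intZ p f (c : R[i]) : 0 < p -> holomorphic_on Om f ->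
  Lp_int Om p (fun z => c * f z) = ((cabs c `^ p)%:E * Lp_int Om p f)%E.
Proof.
move=> p0 /holomorphic_continuous cf.
rewrite !Lp_intE -dom_intZ//.
- by apply: eq_dom_int => z _; rewrite cabsM powRM// cabs_ge0.
- exact: powR_ge0.
- by move=> z _; exact: powR_ge0.
- exact: lsc_on_pow.
Qed.

Lemma in_OLp_lin p f g (c : R[i]) : 0 < p -> in_OLp Om p f -> in_OLp Om p g ->
  in_OLp Om p (fun z => f z + c * g z).
Proof.
move=> p0 [hf If] [hg Ig]; split; first exact: holomorphic_lin.
rewrite Lp_intE; set k := 2 `^ p; set l := cabs c `^ p.
have k0 : 0 < k by exact: powR_gt0.
apply: (@le_lt_trans _ _ (dom_int Om
    (fun z => k * (cabs (f z) `^ p + cabs (c * g z) `^ p)))).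
  apply: dom_int_le => z _; first exact: powR_ge0.
  apply: le_trans (powR_add_le _ _ p0); rewrite ?cabs_ge0//.
  by rewrite ge0_ler_powR ?nnegrE ?addr_ge0 ?cabs_ge0 ?cabsD// ltW.
have lf := lsc_on_pow p0 (holomorphic_continuous hf).
have hcg : holomorphic_on Om (fun z => c * g z).
  have h0 : holomorphic_on Om (fun=> 0).
    move=> z _; exists (fun=> 0) => e e0; exists 1 => // x _.
    rewrite big1 ?subrr ?cabs0 ?mulr_ge0 ?cnorm_ge0 ?ltW//.
    by move=> j _; rewrite mul0r.
  have := holomorphic_lin c h0 hg.
  by under eq_fun do rewrite add0r.
have lg := lsc_on_pow p0 (holomorphic_continuous hcg).
have p_ge0 f' z : Om z -> 0 <= cabs (f' z) `^ p by move=> _; exact: powR_ge0.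
have lfg : lsc_on Om (fun z => cabs (f z) `^ p + cabs (c * g z) `^ p).
  move=> z zO a /= ha; set F := cabs (f z) `^ p in ha *.
  set G := cabs (c * g z) `^ p in ha *; set m := (F + G - a) / 2.
  have m0 : 0 < m by rewrite /m; lra.
  have [d d0 hd] := lf z zO (F - m) ltac:(by rewrite gtrBl).
  have [d' d0' hd'] := lg z zO (G - m) ltac:(by rewrite gtrBl).
  exists (Num.min d d'); first by rewrite lt_min d0.
  move=> z' zO'; rewrite lt_min => /andP[/(hd _ zO') h1 /(hd' _ zO') h2].
  by rewrite /m /= in h1 h2 *; lra.
rewrite dom_intZ ?(ltW k0)//; last by move=> z _; rewrite addr_ge0 ?powR_ge0.
rewrite (dom_intD Om_open (p_ge0 f) (p_ge0 (fun z => c * g z)) lf lg).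
apply: lte_mul_pinfty; rewrite ?lee_fin ?(ltW k0)//.
apply: lte_add_pinfty; first exact: If.
by rewrite -Lp_intE Lp_intZ// lte_mul_pinfty ?lee_fin ?powR_ge0.
Qed.

Lemma Lp_norm_ge0 p f : 0 <= Lp_norm Om p f.
Proof. exact: powR_ge0. Qed.

Lemma Lp_normZ p f (c : R[i]) : 0 < p -> in_OLp Om p f ->
  Lp_norm Om p (fun z => c * f z) = cabs c * Lp_norm Om p f.
Proof.
move=> p0 [hf If]; rewrite /Lp_norm Lp_intZ// fineM//=; last by rewrite ge0_fin_numE ?Lp_int_ge0.
rewrite powRM ?powR_ge0//; last by rewrite fine_ge0// Lp_int_ge0.
by rewrite -powRrM mulfV ?gt_eqF// powRr1// cabs_ge0.
Qed.

(** * Estimates for the metric on the intersection space *)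

Section Metric.
Variables (q : \bar R) (ps : nat -> R).
Hypothesis ps_seq : exponent_seq q ps.
Local Notation X := (in_OLq_minus Om q).

Lemma ps_gt0 j : 0 < ps j.
Proof. by case: ps_seq => h _ _; exact: lt_trans ltr01 (h j). Qed.

(** The sequence increases strictly, so each exponent is below its successor, which is at most the
    limit [q]. *)
Lemma ps_lt j : ((ps j)%:E < q)%E.
Proof.
have [_ hS hq] := ps_seq.
apply: (@lt_le_trans _ _ (ps j.+1)%:E); first by rewrite lte_fin.
have nd : {homo (fun j => (ps j)%:E) : i k / (i <= k)%N >-> (i <= k)%E}.
  by apply/nondecreasing_seqP => i; rewrite lee_fin ltW.
rewrite -(cvg_lim _ hq)//; apply: lime_ge; first exact: cvgP hq.
by exists j.+1 => // k /= jk; exact: nd.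
Qed.

Lemma OLq_ps f j : X f -> in_OLp Om (ps j) f.
Proof.
move=> Xf; apply: Xf; last exact: ps_lt.
by case: ps_seq => h _ _; exact: ltW.
Qed.

Lemma OLq_lin f g (c : R[i]) : X f -> X g -> X (fun z => f z + c * g z).
Proof.
move=> Xf Xg p p1 pq; apply: in_OLp_lin; [exact: lt_le_trans p1|exact: Xf|exact: Xg].
Qed.

Let term f g j : R := 2 ^- j.+1 * (Lp_norm Om (ps j) (fun z => f z - g z)
                 / (1 + Lp_norm Om (ps j) (fun z => f z - g z))).

Lemma frac_le (x y : R) : 0 <= x -> x <= y -> x / (1 + x) <= y / (1 + y).
Proof.
move=> x0 xy; have y0 := le_trans x0 xy.
have x1 : 0 < 1 + x by rewrite ltr_pwDl. have y1 : 0 < 1 + y by rewrite ltr_pwDl.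
by rewrite ler_pdivrMr// mulrAC ler_pdivlMr//; nra.
Qed.

Lemma term_ge0 f g j : 0 <= term f g j.
Proof.
rewrite /term mulr_ge0 ?invr_ge0 ?exprn_ge0// divr_ge0 ?Lp_norm_ge0//.
by rewrite addr_ge0// Lp_norm_ge0.
Qed.

Lemma term_le f g j : term f g j <= 2 ^- j.+1.
Proof.
rewrite /term ler_piMr ?invr_ge0 ?exprn_ge0//.
have := Lp_norm_ge0 (ps j) (fun z => f z - g z); set N := Lp_norm _ _ _ => N0.
by rewrite ler_pdivrMr ?ltr_pwDl//; lra.
Qed.

Lemma sum_half J m : \sum_(J <= j < J + m) (2 : R) ^- j.+1 = 2 ^- J - 2 ^- (J + m).
Proof.
elim: m => [|m IH]; first by rewrite addn0 big_geq ?subrr.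
rewrite addnS big_nat_recr ?leq_addr//= IH exprS invfM.
by field; rewrite !expf_neq0.
Qed.

(** The terms from index [J] on are bounded by the tail [2 ^- J] of a geometric series, uniformly in
    [f] and [g]. *)
Lemma partial_le f g J N :
  \sum_(j < N) term f g j <= \sum_(j < J) term f g j + 2 ^- J.
Proof.
have sub0 k : 0 <= (2 : R) ^- k by rewrite invr_ge0 exprn_ge0.
rewrite -!(big_mkord xpredT (term f g)).
have [NJ|/ltnW JN] := leqP N J.
  rewrite (big_cat_nat (leq0n _) NJ)//= -addrA lerDl addr_ge0// sumr_ge0// => j _.
  exact: term_ge0.
rewrite (big_cat_nat (leq0n _) JN)//= lerD2l -(subnKC JN).
apply: (@le_trans _ _ (\sum_(J <= j < J + (N - J)) (2 : R) ^- j.+1)).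
  by apply: ler_sum => j _; exact: term_le.
by rewrite sum_half gerBl.
Qed.

Lemma OL_dist_cvg f g : cvgn (fun N => \sum_(j < N) term f g j).
Proof.
apply: nondecreasing_is_cvgn.
  apply/nondecreasing_seqP => N; rewrite big_ord_recr/= lerDl; exact: term_ge0.
exists 1 => _ [N _ <-]; apply: le_trans (partial_le f g 0 N) _.
by rewrite big_ord0 add0r expr0 invr1.
Qed.

Lemma OL_dist_le f g J : OL_dist Om ps f g <= \sum_(j < J) term f g j + 2 ^- J.
Proof.
apply: limr_le; first exact: OL_dist_cvg.
by apply: nearW => N; exact: partial_le.
Qed.

Lemma OL_dist_ge f g : term f g 0 <= OL_dist Om ps f g.
Proof.
apply: limr_ge; first exact: OL_dist_cvg.
exists 1%N => // N /= N0; rewrite -(big_mkord xpredT (term f g)).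
rewrite (big_cat_nat (leq0n _) N0)//= big_nat1 lerDl sumr_ge0// => j _; exact: term_ge0.
Qed.

(** If [g] stayed below [M] on the ball, [|f - g|] would be at least [eta] on a small ball about
    [z], and the [L^(p_0)] norm alone would keep [g] away from [f]. *)
Lemma exceed_open f z w (r M : R) : X f -> Om z -> cball w r z -> M < cabs (f z) ->
  exists2 rho : R, 0 < rho & forall g, X g -> OL_dist Om ps f g < rho ->
    exists y, [/\ Om y, cball w r y & M < cabs (g y)].
Proof.
move=> Xf zO zw Mf; set eta := (cabs (f z) - M) / 2.
have eta0 : 0 < eta by rewrite /eta; lra.
have [hf _] := OLq_ps 0 Xf.
have [d1 d10 hd1] := holomorphic_continuous hf zO eta0.
have [d2 d20 hd2] := Om_open zO; have [d3 d30 hd3] := cball_open zw.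
pose d := Num.min d1 (Num.min d2 d3).
have d0 : 0 < d by rewrite !lt_min d10 d20.
have bO : cball z d `<=` Om.
  by move=> y; rewrite /cball /= !lt_min => /and3P[_ h _]; exact: hd2.
have bw : cball z d `<=` cball w r.
  by move=> y; rewrite /cball /= !lt_min => /and3P[_ _ h]; exact: hd3.
have [v v0 hv] := dom_int_ball Om d0.
set p := ps 0; have p0 : 0 < p := ps_gt0 0.
set N := (v * eta `^ p) `^ p^-1.
have N0 : 0 < N by rewrite powR_gt0// mulr_gt0// powR_gt0.
(* This is the first term of the metric when the norm of the difference is exactly [N]. *)
exists (2 ^- 1 * (N / (1 + N))).
  by rewrite mulr_gt0 ?invr_gt0// divr_gt0// ltr_pwDl// ltW.
move=> g Xg; rewrite ltNge => dfg; apply: contrapT => H; move: dfg => /negP; apply.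
have gM y : cball z d y -> cabs (g y) <= M.
  move=> yd; rewrite leNgt; apply/negP => h; apply: H; exists y; split => //.
    exact: bO.
  exact: bw.
apply: le_trans (OL_dist_ge f g); rewrite /term ler_wpM2l ?invr_ge0 ?exprn_ge0//.
apply: frac_le; first exact: ltW.
have [_ Ifg] : in_OLp Om p (fun z => f z - g z).
  have := in_OLp_lin (-1) p0 (OLq_ps 0 Xf) (OLq_ps 0 Xg).
  by under [X in in_OLp _ _ X]eq_fun do rewrite mulN1r.
rewrite /Lp_norm -/p /N; apply: ge0_ler_powR; rewrite ?nnegrE ?invr_ge0 ?(ltW p0)//.
- by rewrite mulr_ge0 ?powR_ge0// ltW.
- by rewrite fine_ge0// Lp_int_ge0.
rewrite -lee_fin fineK ?ge0_fin_numE ?Lp_int_ge0//.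
rewrite Lp_intE; apply: (hv z) => //; [exact: powR_ge0|by move=> y _; exact: powR_ge0|].
move=> y yd; apply: ge0_ler_powR; rewrite ?nnegrE ?cabs_ge0 ?(ltW p0) ?(ltW eta0)//.
have /hd1 : cnorm (fun j => y j - z j) < d1.
  by move: yd; rewrite /cball /= lt_min => /andP[].
rewrite (_ : (fun j => _) = y); last first.
  by apply/funext => j; rewrite addrCA subrr addr0.
move=> h1; have := gM y yd.
have := cabsD (f y - g y) (g y); rewrite subrK.
have := cabsD (f z - f y) (f y); rewrite subrK [cabs (f z - _)]cabsB.
by rewrite /eta /= in h1 *; lra.
Qed.

(** Choose [J] with tail below [e / 2]; by homogeneity the first [J] terms add up to at most [t]
    times a fixed sum of norms of [h]. *)
Lemma OL_dist_perturb f h (e : R) : X f -> X h -> 0 < e ->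
  exists2 t0 : R, 0 < t0 & forall t, 0 < t -> t < t0 ->
    OL_dist Om ps f (fun z => f z + t%:C * h z) < e.
Proof.
move=> Xf Xh e0.
have [J hJ] : exists J, (2 : R) ^- J < e / 2.
  have [J] := @ltr_add_invr R 0 (e / 2) ltac:(by rewrite divr_gt0).
  rewrite add0r => h1; exists J; apply: le_lt_trans h1.
  rewrite lef_pV2 ?posrE ?exprn_gt0// -natrX ler_nat; exact: ltn_expl.
pose C := \sum_(j < J) Lp_norm Om (ps j) h.
have C0 : 0 <= C by apply: sumr_ge0 => j _; exact: Lp_norm_ge0.
have C1 : 0 < 1 + C by rewrite ltr_pwDl.
exists (e / 2 / (1 + C)); first by rewrite !divr_gt0.
move=> t tp; rewrite ltr_pdivlMr// => te.
apply: le_lt_trans (OL_dist_le _ _ J) _.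
suff : \sum_(j < J) term f (fun z => f z + t%:C * h z) j <= t * C by nra.
rewrite mulr_sumr; apply: ler_sum => j _; rewrite /term.
have -> : (fun z => f z - (f z + t%:C * h z)) = (fun z => (- t)%:C * h z).
  by apply/funext => z; rewrite rmorphN /=; ring.
rewrite Lp_normZ ?ps_gt0//; last exact: OLq_ps.
rewrite cabs_real normrN gtr0_norm//; set N := Lp_norm _ _ _.
have N0 : 0 <= t * N by rewrite mulr_ge0 ?Lp_norm_ge0// ltW.
apply: (@le_trans _ _ (t * N / (1 + t * N))).
  rewrite ler_piMl ?divr_ge0 ?addr_ge0// invf_le1 ?exprn_gt0// exprn_ege1//.
  by rewrite ler1n.
by rewrite ler_pdivrMr ?ltr_pwDl// ler_peMr// lerDl.
Qed.

End Metric.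
End FunctionSpace.

(** * Peak functions *)

Section ComplexSeries.
Variable R : realType.
Implicit Types (t : nat -> R[i]) (s : R[i]).

Definition sums_to t s := forall e : R, 0 < e ->
  exists N0, forall N, (N0 <= N)%N -> cabs (\sum_(k < N) t k - s) < e.

Lemma sums_toD t t' s s' : sums_to t s -> sums_to t' s' ->
  sums_to (fun k => t k + t' k) (s + s').
Proof.
move=> ts ts' e e0.
have [N hN] := ts (e / 2) ltac:(by rewrite divr_gt0).
have [N' hN'] := ts' (e / 2) ltac:(by rewrite divr_gt0).
exists (maxn N N') => m; rewrite geq_max => /andP[/hN h1 /hN' h2].
rewrite big_split/= opprD addrACA; apply: le_lt_trans (cabsD _ _) _; lra.
Qed.

Lemma sums_toZ t s c : sums_to t s -> sums_to (fun k => c * t k) (c * s).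
Proof.
move=> ts e e0; have c0 : 0 < 1 + cabs c by rewrite ltr_pwDl// cabs_ge0.
have [N hN] := ts (e / (1 + cabs c)) ltac:(by rewrite divr_gt0).
exists N => m /hN; rewrite -mulr_sumr -mulrBr cabsM ltr_pdivlMr//.
by move=> h; apply: le_lt_trans h; rewrite mulrC ler_wpM2l ?cabs_ge0// lerDr.
Qed.

Lemma sums_to_sum (J : Type) (l : seq J) (T : J -> nat -> R[i]) (S : J -> R[i]) :
  (forall j, sums_to (T j) (S j)) ->
  sums_to (fun k => \sum_(j <- l) T j k) (\sum_(j <- l) S j).
Proof.
move=> TS; elim: l => [|j l IH].
  move=> e e0; exists 0%N => N _; rewrite big_nil subr0 big1 ?cabs0// => k _.
  by rewrite big_nil.
have -> : (fun k => \sum_(i <- j :: l) T i k) =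
    (fun k => T j k + \sum_(i <- l) T i k) by apply/funext => k; exact: big_cons.
by rewrite big_cons; exact: sums_toD.
Qed.

Lemma sums_to_cabs t s (B : R) : sums_to t s ->
  (forall N, \sum_(k < N) cabs (t k) <= B) -> cabs s <= B.
Proof.
move=> ts tB; apply/ler_addgt0Pr => e e0; have [N hN] := ts e e0.
have := cabsD (\sum_(k < N) t k) (s - \sum_(k < N) t k).
rewrite addrCA subrr addr0 [cabs (s - _)]cabsB.
have := hN N (leqnn N); have := tB N; have := cabs_sum (index_enum 'I_N) xpredT (fun k : 'I_N => t k).
lra.
Qed.

(** Nonnegative real parts cannot cancel, so every single term is a lower bound for the sum. *)
Lemma sums_to_Re t s k : sums_to t s -> (forall i, 0 <= Re (t i)) ->
  Re (t k) <= Re s.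
Proof.
move=> ts t0; apply/ler_addgt0Pr => e e0; have [N hN] := ts e e0.
have Nk : (k < maxn N k.+1)%N by rewrite leq_max ltnS leqnn orbT.
have := hN _ (leq_maxl N k.+1) => /(le_lt_trans (Re_le_cabs _)).
rewrite ReD ReN Re_sum ltr_norml (bigD1 (Ordinal Nk))//=.
have : 0 <= \sum_(i < maxn N k.+1 | i != Ordinal Nk) Re (t i) by exact: sumr_ge0.
lra.
Qed.

Lemma cvg_series_le (u : nat -> R) (B : R) :
  (forall N, \sum_(k < N) `|u k| <= B) -> cvgn (series u).
Proof.
move=> uB; apply: normed_cvg.
have -> : [normed series u] = (fun N => \sum_(k < N) `|u k|).
  by apply/funext => N; exact: big_mkord.
apply: nondecreasing_is_cvgn; last by exists B => _ [N _ <-].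
by apply/nondecreasing_seqP => N; rewrite big_ord_recr/= lerDl.
Qed.

Lemma sums_to_exists t (B : R) : (forall N, \sum_(k < N) cabs (t k) <= B) ->
  exists s, sums_to t s.
Proof.
move=> tB.
have /cvg_ex[x cx] : cvgn (series (fun k => Re (t k))).
  apply: (@cvg_series_le _ B) => N; apply: le_trans (tB N).
  by apply: ler_sum => k _; exact: Re_le_cabs.
have /cvg_ex[y cy] : cvgn (series (fun k => Im (t k))).
  apply: (@cvg_series_le _ B) => N; apply: le_trans (tB N).
  by apply: ler_sum => k _; exact: Im_le_cabs.
exists (Complex x y) => e e0.
move/cvgrPdist_lt : cx => /(_ (e / 2)); rewrite divr_gt0// => /(_ isT)[N _ hN].
move/cvgrPdist_lt : cy => /(_ (e / 2)); rewrite divr_gt0// => /(_ isT)[N' _ hN'].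
exists (maxn N N') => m; rewrite geq_max => /andP[/hN h1 /hN' h2].
apply: le_lt_trans (cabs_le_ReIm _) _.
rewrite ReD ImD ReN ImN Re_sum Im_sum /=.
rewrite /series /= !big_mkord distrC in h1.
rewrite /series /= !big_mkord distrC in h2.
lra.
Qed.

Lemma sum_geo_le N : \sum_(k < N) ((2 : R) ^+ k)^-1 <= 2.
Proof.
suff -> : \sum_(k < N) ((2 : R) ^+ k)^-1 = 2 - 2 * (2 ^+ N)^-1.
  by rewrite gerBl mulr_ge0// invr_ge0 exprn_ge0.
elim: N => [|N IH]; first by rewrite big_ord0 expr0 invr1 mulr1 subrr.
by rewrite big_ord_recr/= IH exprS; field; rewrite expf_neq0.
Qed.

End ComplexSeries.

(** * The peak functions [e / (e + u)] and their estimates *)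

Section PeakFunction.
Variable R : realType.
Implicit Types (u v : R[i]) (e : R).
Local Open Scope complex_scope.

Definition ratio e u : R[i] := e%:C / (e%:C + u).

Lemma den_ge e u : 0 < e -> 0 <= Re u -> e <= cabs (e%:C + u) /\ Re u <= cabs (e%:C + u).
Proof.
move=> e0 u0; have eu : 0 <= e + Re u by rewrite addr_ge0// ltW.
by have := Re_le_cabs (e%:C + u); rewrite ReD /= ger0_norm// => h; split; lra.
Qed.

Lemma den_neq0 e u : 0 < e -> 0 <= Re u -> e%:C + u != 0.
Proof.
move=> e0 u0; apply/eqP => h; have [] := den_ge e0 u0.
by rewrite h cabs0 leNgt e0.
Qed.

Lemma cabs_ratio e u : 0 < e -> cabs (ratio e u) = e / cabs (e%:C + u).
Proof. by move=> e0; rewrite cabsM cabsV cabs_real gtr0_norm. Qed.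

Lemma ratio_le1 e u : 0 < e -> 0 <= Re u -> cabs (ratio e u) <= 1.
Proof.
move=> e0 u0; have [h _] := den_ge e0 u0.
by rewrite cabs_ratio// ler_pdivrMr ?mul1r// (lt_le_trans e0).
Qed.

Lemma ratio_le e u (r : R) : 0 < e -> 0 < r -> r <= Re u ->
  cabs (ratio e u) <= e / r.
Proof.
move=> e0 r0 ru; have [_ h] := den_ge e0 (le_trans (ltW r0) ru).
rewrite cabs_ratio// ler_wpM2l ?(ltW e0)// lef_pV2 ?posrE//.
  exact: le_trans ru h.
exact: lt_le_trans (le_trans ru h).
Qed.

Lemma Re_ratio e u : 0 < e -> 0 <= Re u ->
  Re (ratio e u) = e * (e + Re u) / cabs (e%:C + u) ^+ 2.
Proof.
move=> e0 u0; rewrite cabs_sq /ratio; case: u u0 => [x y] /= u0.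
by rewrite !add0r !mul0r ?subr0; field; nra.
Qed.

Lemma Re_ratio_ge0 e u : 0 < e -> 0 <= Re u -> 0 <= Re (ratio e u).
Proof.
by move=> e0 u0; rewrite Re_ratio// divr_ge0 ?sqr_ge0// mulr_ge0 ?addr_ge0 ?(ltW e0).
Qed.

(** For [|u| <= e], [|e + u|^2 = e^2 + 2 e Re u + |u|^2 <= 2 e (e + Re u)]. *)
Lemma Re_ratio_ge e u : 0 < e -> 0 <= Re u -> cabs u <= e ->
  1 / 2 <= Re (ratio e u).
Proof.
move=> e0 u0 ue; rewrite Re_ratio//.
have h : 0 < cabs (e%:C + u) ^+ 2.
  by rewrite exprn_gt0// (lt_le_trans e0)//; case: (den_ge e0 u0).
rewrite ler_pdivlMr//.
have : cabs u ^+ 2 <= e ^+ 2 by rewrite ler_pXn2r ?nnegrE ?cabs_ge0 ?(ltW e0).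
by rewrite !cabs_sq; case: u u0 {ue h} => [x y] /= u0; nra.
Qed.

(** The remainder is exactly [e v^2 / ((e + u)^2 (e + u + v))], and its denominator is at least
    [r^2 * (r / 2)]. The bound carries the factor [e], which later makes it summable. *)
Lemma ratio_taylor e u v (r : R) : 0 < e -> 0 < r -> r <= Re u ->
  cabs v <= r / 2 ->
  cabs (ratio e (u + v) - ratio e u + e%:C / (e%:C + u) ^+ 2 * v) <=
  e * (2 / r ^+ 3) * cabs v ^+ 2.
Proof.
move=> e0 r0 ru vr.
have uv : r / 2 <= Re (u + v).
  have := le_trans (Re_le_cabs v) vr; rewrite ReD ler_norml; lra.
have u0 := le_trans (ltW r0) ru.
have uv0 : 0 <= Re (u + v) by lra.
rewrite (_ : _ + _ = e%:C * v ^+ 2 / ((e%:C + u) ^+ 2 * (e%:C + (u + v)))); last first.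
  by rewrite /ratio; field; rewrite !den_neq0.
have [_ h1] := den_ge e0 u0; have [_ h2] := den_ge e0 uv0.
rewrite !expr2 !cabsM cabsV !cabsM cabs_real gtr0_norm//.
set A := cabs (_ + u) in h1 *; set B := cabs _ in h2 *; set V := cabs v.
have A0 : r <= A by lra.
have B0 : r / 2 <= B by lra.
rewrite -mulrA -[leRHS]mulrA ler_wpM2l ?(ltW e0)// mulrC.
rewrite ler_wpM2r ?mulr_ge0 ?cabs_ge0//.
rewrite -[2 / _]invrK lef_pV2 ?posrE ?invr_gt0 ?divr_gt0 ?mulr_gt0 ?exprn_gt0//; [|lra|lra|lra].
rewrite invf_div (_ : r ^+ 3 / 2 = r * r * (r / 2)); last by field.
by rewrite ler_pM ?mulr_ge0 ?ler_pM ?(ltW r0)// divr_ge0 ?(ltW r0).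
Qed.

Variable n : nat.
Implicit Types (a z x w : cvec R n) (b : R[i]) (Om : set (cvec R n)).

Definition affine a b z := \sum_(j < n) a j * z j + b.

Lemma affineD a b z x :
  affine a b (fun j => z j + x j) = affine a b z + \sum_(j < n) a j * x j.
Proof.
rewrite /affine addrAC -big_split/=; congr (_ + _); apply: eq_bigr => j _.
by rewrite mulrDr.
Qed.

Lemma cabs_unit_lin a x : cnorm a = 1 ->
  cabs (\sum_(j < n) a j * x j) <= n%:R * cnorm x.
Proof.
move=> a1; apply: le_trans (cabs_lin a x) _; rewrite ler_wpM2r ?cnorm_ge0//.
rewrite -[n in leRHS]card_ord -sumr_const; apply: ler_sum => j _.
by rewrite -a1; exact: coord_le_cnorm.
Qed.

(** Moving from [z] by [r / 2] against the conjugate of [a] stays in [Om] and lowers the real part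
    by exactly [r / 2]. The bound is the same for all [a] and [b]. *)
Lemma affine_Re_ge Om a b z (r : R) : cnorm a = 1 ->
  (forall y, Om y -> 0 <= Re (affine a b y)) -> 0 < r -> cball z r `<=` Om ->
  r / 2 <= Re (affine a b z).
Proof.
move=> a1 aO r0 zr.
have /aO : Om (fun j => z j + (- (r / 2))%:C * (a j)^*).
  apply: zr; rewrite /cball /=.
  rewrite (_ : (fun j => _) = (fun j => (- (r / 2))%:C * (a j)^*)).
    by rewrite cnormZ cnorm_conj a1 cabs_real normrN ger0_norm ?divr_ge0 ?ltW//; lra.
  by apply/funext => j; rewrite addrAC subrr add0r.
rewrite affineD ReD (_ : \sum_(j < n) _ = (- (r / 2))%:C); first by rewrite /=; lra.
transitivity (\sum_(j < n) (- (r / 2))%:C * (a j)^* * (1%:C * a j)).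
  by apply: eq_bigr => j _; rewrite mul1r mulrC.
by rewrite sum_conjZ a1 expr1n !mulr1.
Qed.

Lemma ratio_affine_taylor Om a b e z (r : R) : 0 < e -> cnorm a = 1 ->
  (forall y, Om y -> 0 <= Re (affine a b y)) -> 0 < r -> cball z r `<=` Om ->
  forall x, cnorm x <= r / (4 * n.+1%:R) ->
  cabs (ratio e (affine a b (fun j => z j + x j)) - ratio e (affine a b z) -
    \sum_(j < n) (- (e%:C / (e%:C + affine a b z) ^+ 2) * a j) * x j) <=
  e * (16 * n.+1%:R ^+ 2 / r ^+ 3) * cnorm x ^+ 2.
Proof.
move=> e0 a1 aO r0 zr x; rewrite ler_pdivlMr ?mulr_gt0// => xr.
have ur := affine_Re_ge a1 aO r0 zr.
have vx : cabs (\sum_(j < n) a j * x j) <= n.+1%:R * cnorm x.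
  apply: le_trans (cabs_unit_lin x a1) _.
  by rewrite ler_wpM2r ?cnorm_ge0// ler_nat.
have r2 : 0 < r / 2 by rewrite divr_gt0.
have vr : cabs (\sum_(j < n) a j * x j) <= r / 2 / 2 by lra.
have := ratio_taylor e0 r2 ur vr; rewrite -affineD => h.
under eq_bigr do rewrite mulNr mulNr.
rewrite sumrN opprK; under eq_bigr do rewrite -mulrA.
rewrite -mulr_sumr; apply: le_trans h _.
have v2 : cabs (\sum_(j < n) a j * x j) ^+ 2 <= (n.+1%:R * cnorm x) ^+ 2.
  by rewrite ler_pXn2r ?nnegrE ?cabs_ge0 ?mulr_ge0 ?cnorm_ge0.
apply: le_trans (ler_wpM2l _ v2) _.
  by rewrite mulr_ge0 ?(ltW e0)// divr_ge0 ?exprn_ge0 ?ltW.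
rewrite le_eqVlt; apply/orP; left; apply/eqP; field; lra.
Qed.

Lemma ratio_affine_holomorphic Om a b e : copen Om -> 0 < e -> cnorm a = 1 ->
  (forall y, Om y -> 0 <= Re (affine a b y)) ->
  holomorphic_on Om (fun z => ratio e (affine a b z)).
Proof.
move=> oO e0 a1 aO z zO; have [r r0 zr] := oO z zO.
exists (fun j => - (e%:C / (e%:C + affine a b z) ^+ 2) * a j) => d d0.
set C := e * (16 * n.+1%:R ^+ 2 / r ^+ 3).
have C0 : 0 < C by rewrite mulr_gt0// divr_gt0 ?mulr_gt0 ?exprn_gt0 ?ltr0n.
exists (Num.min (r / (4 * n.+1%:R)) (d / C)).
  by rewrite lt_min !divr_gt0// mulr_gt0.
move=> x; rewrite lt_min => /andP[/ltW h1 h2].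
apply: le_trans (ratio_affine_taylor e0 a1 aO r0 zr h1) _.
by rewrite -/C expr2 mulrA ler_wpM2r ?cnorm_ge0// -ler_pdivlMl// mulrC ltW.
Qed.

(** The hyperplane may change with [e_ i], but [affine_Re_ge] bounds the real part at a given [z]
    independently of [i]. Hence the peak functions tend to 0 pointwise, and by dominated convergence
    so do their integrals. *)
Lemma peak_exists Om w (d eta : R) :
  copen Om -> cbounded Om -> cconvex Om -> cboundary Om w -> 0 < d -> 0 < eta ->
  exists p : cvec R n * R[i] * R, let: (a, b, e) := p in
    [/\ cnorm a = 1, forall y, Om y -> 0 <= Re (affine a b y), 0 < e <= eta,
        exists y, [/\ Om y, cball w d y & cabs (affine a b y) <= e] &
        (dom_int Om (fun z => cabs (ratio e (affine a b z))) <= eta%:E)%E].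
Proof.
move=> oO bO cO bw d0 eta0.
pose e_ i : R := Num.min eta i.+1%:R^-1.
have e0 i : 0 < e_ i by rewrite lt_min eta0 invr_gt0 ltr0n.
have /choice[ab hab] (i : nat) : exists ab : cvec R n * R[i],
    [/\ cnorm ab.1 = 1, forall y, Om y -> 0 <= Re (affine ab.1 ab.2 y) &
      exists y, [/\ Om y, cball w d y & cabs (affine ab.1 ab.2 y) <= e_ i]].
  by have [a [b h]] := support_approx oO bO cO bw d0 (e0 i); exists (a, b).
pose g_ i z := cabs (ratio (e_ i) (affine (ab i).1 (ab i).2 z)).
have g0 i z : Om z -> 0 <= g_ i z by move=> _; exact: cabs_ge0.
have g1 i z : Om z -> g_ i z <= 1.
  by move=> zO; have [_ h _] := hab i; apply: ratio_le1 => //; exact: h.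
have lg i : lsc_on Om (g_ i).
  have [a1 h _] := hab i.
  have := lsc_on_pow ltr01 (holomorphic_continuous
    (ratio_affine_holomorphic oO (e0 i) a1 h)).
  by under eq_fun do rewrite powRr1 ?cabs_ge0//.
have gc z : Om z -> (fun i => g_ i z) @ \oo --> (0 : R).
  move=> zO; have [r r0 zr] := oO z zO.
  apply/cvgrPdist_lt => t t0.
  have tr : 0 < t * (r / 2) by rewrite mulr_gt0 ?divr_gt0.
  near=> i; rewrite sub0r normrN ger0_norm ?g0//.
  have [a1 h _] := hab i; have hr := affine_Re_ge a1 h r0 zr.
  apply: le_lt_trans (ratio_le (e0 i) _ hr) _; first by rewrite divr_gt0.
  rewrite ltr_pdivrMr ?divr_gt0//.
  apply: (@le_lt_trans _ _ i.+1%:R^-1); first by rewrite ge_min lexx orbT.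
  by near: i; exact: near_infty_natSinv_lt (PosNum tr).
have dc := dom_int_dominated oO bO g0 g1 lg gc.
have [i hi] : exists i, (dom_int Om (g_ i) <= eta%:E)%E.
  have /fine_cvgP[fin] := dc; move/cvgrPdist_lt => /(_ eta eta0) lim.
  have [i [h1 h2]] : exists i, dom_int Om (g_ i) \is a fin_num /\
      `|0 - fine (dom_int Om (g_ i))| < eta.
    by have [i [h1 h2]] := filter_ex (filterI fin lim); exists i.
  exists i; rewrite -(fineK h1) lee_fin; apply: ltW.
  by apply: le_lt_trans h2; rewrite sub0r normrN ler_norm.
have [a1 h hy] := hab i; exists ((ab i).1, (ab i).2, e_ i); split => //.
by rewrite e0 ge_min lexx.
Unshelve. all: by end_near. Qed.

End PeakFunction.

(** * A totally unbounded function *)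

Section TotallyUnbounded.
Variables (R : realType) (n : nat) (Om : set (cvec R n)).
Hypotheses (Om_open : copen Om) (Om_bounded : cbounded Om) (Om_convex : cconvex Om).
Variables (W : nat -> cvec R n) (r : nat -> R).
Hypothesis W_boundary : forall k, cboundary Om (W k) /\ 0 < r k.
Local Open Scope complex_scope.

(** * The series of peak functions with weights [2 ^+ k] *)

Section PeakSeries.
Variables (a : nat -> cvec R n) (b : nat -> R[i]) (e : nat -> R).
Hypothesis a1 : forall k, cnorm (a k) = 1.
Hypothesis Re_affine_ge0 : forall k y, Om y -> 0 <= Re (affine (a k) (b k) y).
Hypothesis e_gt0 : forall k, 0 < e k.
(** This decay makes [2 ^+ k * e k] summable, hence the series and its derivatives converge; the
    factorial in [int_tau] beats [(4 ^+ k) ^ p] for every [p] at once. *)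
Hypothesis e_le4 : forall k, e k <= (4 ^+ k)^-1.
Let tau k z := ratio (e k) (affine (a k) (b k) z).
Hypothesis int_tau : forall k,
  (dom_int Om (fun z => cabs (tau k z)) <= ((k`!)%:R^-1)%:E)%E.
Variable h : cvec R n -> R[i].
Hypothesis hE : forall z, Om z -> sums_to (fun k => (2 ^+ k)%:C * tau k z) (h z).

Lemma cabs_pow2 k : cabs ((2 : R) ^+ k)%:C = 2 ^+ k.
Proof. by rewrite cabs_real ger0_norm// exprn_ge0. Qed.

Lemma pow2_e k : 2 ^+ k * e k <= (2 ^+ k)^-1.
Proof.
apply: le_trans (ler_wpM2l (exprn_ge0 k (ler0n _ 2)) (e_le4 k)) _.
rewrite (_ : 4 ^+ k = 2 ^+ k * 2 ^+ k); last by rewrite -exprMn -natrM.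
by rewrite invfM mulrA mulfV ?mul1r// expf_neq0.
Qed.

Lemma sum_pow2_e_le (C : R) (f : nat -> R) : 0 <= C ->
  (forall k, f k <= 2 ^+ k * (e k * C)) -> forall N, \sum_(k < N) f k <= 2 * C.
Proof.
move=> C0 fC N; apply: le_trans (ler_wpM2r C0 (sum_geo_le R N)).
rewrite mulr_suml; apply: ler_sum => k _; apply: le_trans (fC k) _.
by rewrite mulrA ler_wpM2r// pow2_e.
Qed.

Lemma sums_to_pow2_le t s (C : R) : sums_to t s -> 0 <= C ->
  (forall k, cabs (t k) <= 2 ^+ k * (e k * C)) -> cabs s <= 2 * C.
Proof. by move=> ts C0 tC; apply: (sums_to_cabs ts); exact: sum_pow2_e_le tC. Qed.

Lemma sums_to_pow2_exists t (C : R) : 0 <= C ->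
  (forall k, cabs (t k) <= 2 ^+ k * (e k * C)) -> exists s, sums_to t s.
Proof.
by move=> C0 tC; apply: (sums_to_exists (B := 2 * C)); exact: sum_pow2_e_le tC.
Qed.

(** Termwise differentiation: the remainder of the [k]-th term is at most [2 ^+ k * e k] times
    [C |x|^2] with [C] independent of [k], so the remainders sum to at most [2 C |x|^2]. *)
Lemma peak_series_holomorphic : holomorphic_on Om h.
Proof.
move=> z zO; have [d d0 zd] := Om_open zO.
have ur k : d / 2 <= Re (affine (a k) (b k) z).
  exact: affine_Re_ge (a1 k) (@Re_affine_ge0 k) d0 zd.
pose al k (j : 'I_n) : R[i] :=
  - ((e k)%:C / ((e k)%:C + affine (a k) (b k) z) ^+ 2) * a k j.
have d20 : 0 < d / 2 by rewrite divr_gt0.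
have /choice[A hA] (j : 'I_n) : exists s, sums_to (fun k => (2 ^+ k)%:C * al k j) s.
  apply: (@sums_to_pow2_exists _ ((d / 2) ^- 2)) => [|k].
    by rewrite invr_ge0 exprn_ge0// ltW.
  rewrite cabsM cabs_pow2 ler_wpM2l ?exprn_ge0//.
  rewrite /al !cabsM cabsN cabsM cabs_real gtr0_norm// cabsV expr2 cabsM.
  have aj : cabs (a k j) <= 1 by rewrite -(a1 k); exact: coord_le_cnorm.
  have [_] := den_ge (e_gt0 k) (@Re_affine_ge0 k z zO).
  move/(le_trans (ur k)) => den; have den0 := lt_le_trans d20 den.
  rewrite -mulrA ler_wpM2l ?(ltW (e_gt0 k))//.
  rewrite -[leRHS]mulr1 ler_pM ?cabs_ge0 ?invr_ge0 ?mulr_ge0 ?cabs_ge0//.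
  rewrite lef_pV2 ?posrE ?mulr_gt0 ?exprn_gt0// expr2.
  by rewrite ler_pM// ltW.
exists A => c c0.
pose C := 16 * n.+1%:R ^+ 2 / d ^+ 3.
have C0 : 0 < C by rewrite divr_gt0 ?mulr_gt0 ?exprn_gt0 ?ltr0n.
have C2 : 0 < 2 * C by rewrite pmulr_rgt0.
exists (Num.min (d / (4 * n.+1%:R)) (c / (2 * C))).
  by rewrite lt_min !divr_gt0// mulr_gt0.
move=> x; rewrite lt_min => /andP[xd xc].
have zxO : Om (fun j => z j + x j).
  apply: zd; rewrite /cball /= (_ : (fun j => _) = x); last first.
    by apply/funext => j; rewrite addrAC subrr add0r.
  apply: lt_trans xd _; rewrite ltr_pdivrMr ?mulr_gt0// ltr_pMr//.
  by have : 1 <= n.+1%:R :> R; [rewrite ler1n|lra].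
have hs := sums_toD (hE zxO) (sums_toZ (-1)
  (sums_toD (hE zO) (sums_to_sum (index_enum 'I_n) (fun j => sums_toZ (x j) (hA j))))).
have -> : h (fun j => z j + x j) - h z - \sum_(j < n) A j * x j =
    h (fun j => z j + x j) + -1 * (h z + \sum_(j < n) x j * A j).
  by rewrite mulN1r opprD addrA; under [in RHS]eq_bigr do rewrite mulrC.
apply: le_trans (_ : 2 * (C * cnorm x ^+ 2) <= _); last first.
  have := ltW xc; rewrite ler_pdivlMr// => h1.
  rewrite [leLHS](_ : _ = (cnorm x * (2 * C)) * cnorm x); last by ring.
  by rewrite ler_wpM2r ?cnorm_ge0.
apply: (sums_to_pow2_le hs) => [|k].
  by rewrite mulr_ge0 ?sqr_ge0 ?(ltW C0).
have := ratio_affine_taylor (e_gt0 k) (a1 k) (@Re_affine_ge0 k) d0 zd (ltW xd).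
rewrite -/C -mulrA => /(ler_wpM2l (exprn_ge0 k (ler0n R 2))); apply: le_trans.
rewrite -[X in _ <= X * cabs _]cabs_pow2 -cabsM le_eqVlt; apply/orP; left; apply/eqP; congr cabs.
rewrite !mulrBr mulN1r opprD addrA; congr (_ - _) => //.
rewrite mulr_sumr; apply: eq_bigr => j _; rewrite /al; ring.
Qed.

(** A pigeonhole argument: if [4 * 4^k |tau_k| < |h|] for all [k], the terms [2^k |tau_k|] would sum
    to at most [|h| / 2]. So one index satisfies the reverse inequality, and [|tau_k|^p <= |tau_k|]
    because [|tau_k| <= 1] and [p >= 1]. *)
Lemma peak_series_pow (p : R) z : 1 <= p -> Om z ->
  ((cabs (h z) `^ p)%:E <=
    \sum_(k <oo) ((4 * 4 ^+ k) `^ p * cabs (tau k z))%:E)%E.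
Proof.
move=> p1 zO; have p0 : 0 < p := lt_le_trans ltr01 p1.
have t0 k : (0 <= ((4 * 4 ^+ k) `^ p * cabs (tau k z))%:E)%E.
  by rewrite lee_fin mulr_ge0 ?powR_ge0 ?cabs_ge0.
have [h0|h0] := eqVneq (cabs (h z)) 0.
  by rewrite h0 powR0 ?gt_eqF//; apply: nneseries_ge0 => k _ _; exact: t0.
have {}h0 : 0 < cabs (h z) by rewrite lt_neqAle eq_sym h0 cabs_ge0.
have [k hk] : exists k, cabs (h z) <= 4 * 4 ^+ k * cabs (tau k z).
  apply: contrapT => /forallNP H.
  suff : cabs (h z) <= cabs (h z) / 2 by lra.
  apply: (sums_to_cabs (hE zO)) => N.
  rewrite [leRHS](_ : _ = cabs (h z) / 4 * 2); last by field.
  apply: le_trans (ler_wpM2l _ (sum_geo_le R N)); last by rewrite divr_ge0// ltW.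
  rewrite mulr_sumr; apply: ler_sum => k _; rewrite cabsM cabs_pow2.
  have /negP := H k; rewrite -ltNge => /ltW hk.
  have k2 : 0 < (2 : R) ^+ k by rewrite exprn_gt0.
  have e4 : (4 : R) ^+ k = 2 ^+ k * 2 ^+ k by rewrite -exprMn -natrM.
  rewrite e4 in hk; rewrite ler_pdivlMr//; nra.
have tk1 : cabs (tau k z) <= 1.
  exact: ratio_le1 (@e_gt0 k) (@Re_affine_ge0 k z zO).
have tk0 : 0 < cabs (tau k z).
  have := lt_le_trans h0 hk; rewrite pmulr_rgt0// mulr_gt0// exprn_gt0//.
apply: le_trans (_ : (_ <= ((4 * 4 ^+ k) `^ p * cabs (tau k z))%:E)%E) _.
  rewrite lee_fin; apply: le_trans (_ : (4 * 4 ^+ k * cabs (tau k z)) `^ p <= _).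
    by rewrite ge0_ler_powR ?nnegrE ?(ltW p0) ?(ltW h0)// !mulr_ge0 ?exprn_ge0 ?cabs_ge0.
  rewrite powRM ?cabs_ge0 ?mulr_ge0 ?exprn_ge0// ler_wpM2l ?powR_ge0//.
  by apply: ge1r_powR => //; rewrite tk0 tk1.
apply: le_trans (nneseries_lim_ge k.+1 (fun i _ _ => t0 i)).
by rewrite big_nat_recr//= leeDr// sume_ge0.
Qed.

Lemma peak_series_OLp (p : R) : 1 <= p -> in_OLp Om p h.
Proof.
move=> p1; have p0 : 0 < p := lt_le_trans ltr01 p1.
split; first exact: peak_series_holomorphic.
have ltau k : lsc_on Om (fun z => cabs (tau k z)).
  have := lsc_on_pow ltr01 (holomorphic_continuous
    (ratio_affine_holomorphic Om_open (e_gt0 k) (a1 k) (@Re_affine_ge0 k))).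
  by under eq_fun do rewrite powRr1 ?cabs_ge0//.
have c0 k : 0 < (4 * (4 : R) ^+ k) `^ p by rewrite powR_gt0// mulr_gt0// exprn_gt0.
have t0 k z : Om z -> 0 <= (4 * 4 ^+ k) `^ p * cabs (tau k z).
  by move=> _; rewrite mulr_ge0 ?powR_ge0 ?cabs_ge0.
rewrite Lp_intE; apply: le_lt_trans (dom_int_le_nneseries Om_open _ t0 _ _) _.
- by move=> z _; exact: powR_ge0.
- by move=> k; exact: lsc_onZ.
- by move=> z zO; exact: peak_series_pow.
(* Since [(4 * 4^k)^p / k! = 4^p (4^p)^k / k!], the series of integrals is dominated by an
   exponential series. *)
apply: (@le_lt_trans _ _ (4 `^ p * expR (4 `^ p))%:E); last exact: ltry.
apply: lime_le.
  by apply: is_cvg_nneseries => k _ _; apply: dom_int_ge0; exact: t0.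
apply: nearW => N.
apply: (@le_trans _ _ (\sum_(0 <= k < N) (4 `^ p * exp_coeff (4 `^ p) k)%:E)%E).
  apply: lee_sum => k _.
  rewrite dom_intZ ?(ltW (c0 k))//; last by move=> z _; exact: cabs_ge0.
  apply: le_trans (lee_wpmul2l _ (int_tau k)) _; first by rewrite lee_fin ltW.
  rewrite -EFinM lee_fin exp_coeffE powRM ?exprn_ge0// -mulrA ler_wpM2l ?powR_ge0//.
  rewrite mulrC ler_wpM2l ?invr_ge0//.
  by rewrite -powR_mulrn// -powRrM mulrC powRrM powR_mulrn// powR_ge0.
rewrite sumEFin lee_fin -mulr_sumr ler_wpM2l ?powR_ge0//.
apply: (nondecreasing_cvgn_le (u_ := series (exp_coeff (4 `^ p)))); last first.
  exact: is_cvg_series_exp_coeff.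
apply/nondecreasing_seqP => m; rewrite !seriesEnat /= big_nat_recr//= lerDl.
by rewrite exp_coeff_ge0 ?powR_ge0.
Qed.

Lemma peak_series_ge k y : Om y -> cabs (affine (a k) (b k) y) <= e k ->
  2 ^+ k / 2 <= cabs (h y).
Proof.
move=> yO ye; have k2 : 0 <= (2 : R) ^+ k by rewrite exprn_ge0.
apply: le_trans (le_trans (ler_norm _) (Re_le_cabs (h y))).
have Re_t i : Re ((2 ^+ i)%:C * tau i y) = 2 ^+ i * Re (tau i y).
  by rewrite ReM /= mul0r subr0.
apply: le_trans (sums_to_Re k (hE yO) _) => [|i].
  rewrite Re_t ler_wpM2l//; have := Re_ratio_ge (e_gt0 k) (@Re_affine_ge0 k y yO) ye.
  by rewrite div1r.
rewrite Re_t mulr_ge0 ?exprn_ge0//.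
exact: Re_ratio_ge0 (e_gt0 i) (@Re_affine_ge0 i y yO).
Qed.

End PeakSeries.

Lemma unbounded_exists : exists h : cvec R n -> R[i],
  (forall p, 1 <= p -> in_OLp Om p h) /\
  forall k, exists y, [/\ Om y, cball (W k) (r k) y & 2 ^+ k / 2 <= cabs (h y)].
Proof.
pose eta k : R := Num.min (4 ^+ k)^-1 ((k`!)%:R^-1).
have eta0 k : 0 < eta k by rewrite lt_min !invr_gt0 exprn_gt0// ltr0n fact_gt0.
have /choice[P hP] (k : nat) := peak_exists Om_open Om_bounded Om_convex
  (W_boundary k).1 (W_boundary k).2 (eta0 k).
pose a k := (P k).1.1; pose b k := (P k).1.2; pose e k := (P k).2.
have {}hP k : [/\ cnorm (a k) = 1, forall y, Om y -> 0 <= Re (affine (a k) (b k) y),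
    0 < e k <= eta k,
    exists y, [/\ Om y, cball (W k) (r k) y & cabs (affine (a k) (b k) y) <= e k] &
    (dom_int Om (fun z => cabs (ratio (e k) (affine (a k) (b k) z))) <= (eta k)%:E)%E].
  by move: (hP k); rewrite /a /b /e; case: (P k) => [[]].
have a1 k : cnorm (a k) = 1 by have [] := hP k.
have aO k y : Om y -> 0 <= Re (affine (a k) (b k) y) by have [_ h1 _ _ _] := hP k; exact: h1.
have e0 k : 0 < e k by have [_ _ /andP[]] := hP k.
have e4 k : e k <= (4 ^+ k)^-1.
  have [_ _ /andP[_ h1] _ _] := hP k; apply: (le_trans h1).
  by rewrite ge_min lexx.
have it k : (dom_int Om (fun z => cabs (ratio (e k) (affine (a k) (b k) z))) <=
    ((k`!)%:R^-1)%:E)%E.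
  have [_ _ _ _ h1] := hP k; apply: (le_trans h1).
  by rewrite lee_fin ge_min lexx orbT.
(* Outside [Om] the value of [h] is arbitrary, here 0; inside, [|tau_k| <= e_k / (d / 2)] gives
   absolute convergence. *)
have /choice[h hE] (z : cvec R n) : exists s, Om z ->
    sums_to (fun k => (2 ^+ k)%:C * ratio (e k) (affine (a k) (b k) z)) s.
  have [zO|] := pselect (Om z); last by exists 0.
  have [d d0 zd] := Om_open zO; have d20 : 0 < d / 2 by rewrite divr_gt0.
  have [||s hs] := sums_to_pow2_exists e4 (t := fun k =>
    (2 ^+ k)%:C * ratio (e k) (affine (a k) (b k) z)) (C := (d / 2)^-1).
  - by rewrite invr_ge0 ltW.
  - move=> k.
    rewrite cabsM cabs_pow2 ler_wpM2l ?exprn_ge0//; apply: ratio_le => //.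
    exact: affine_Re_ge (a1 k) (aO k) d0 zd.
  by exists s.
exists h; split => [p p1|k]; first exact: (peak_series_OLp a1 aO e0 e4 it hE).
have [_ _ _ [y [yO yW ye]] _] := hP k; exists y; split => //.
exact: (peak_series_ge aO e0 hE) ye.
Qed.

Hypothesis W_base : forall w d N, cboundary Om w -> 0 < d ->
  exists2 k, (N <= k)%N & cball (W k) (r k) `<=` cball w d.

Lemma totally_unbounded_exists : exists h : cvec R n -> R[i],
  (forall p, 1 <= p -> in_OLp Om p h) /\ totally_unbounded Om h.
Proof.
have [h [hp hy]] := unbounded_exists; exists h; split => //.
apply/(totally_unboundedP _ Om_convex) => w bw d d0 M.
(* A smaller ball with index [k > |2 M|] is used, so that [2^k / 2] exceeds [M]. *)
have [k Mk sub] := W_base (Num.bound `|2 * M|) bw d0.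
have [y [yO yW yh]] := hy k; exists y; split => //; first exact: sub.
apply: lt_le_trans yh; rewrite ltr_pdivlMr// mulrC.
apply: (@lt_le_trans _ _ (Num.bound `|2 * M|)%:R).
  by apply: le_lt_trans (ler_norm _) _; exact: archi_boundP.
by rewrite -natrX ler_nat (leq_trans Mk)// ltnW// ltn_expl.
Qed.

(* For a fixed ball, at most one [t] makes [f + t h] bounded there, since [h]
   is not; so all but countably many [t] are good. *)
Lemma totally_unbounded_perturb (f h : cvec R n -> R[i]) (t0 : R) :
  totally_unbounded Om h -> 0 < t0 ->
  exists t, [/\ 0 < t, t < t0 & totally_unbounded Om (fun z => f z + t%:C * h z)].
Proof.
move=> /(totally_unboundedP _ Om_convex) hU t0p.
pose bad k := [set t : R | exists M : R, forall z, Om z -> cball (W k) (r k) z ->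
  cabs (f z + t%:C * h z) <= M].
have bad1 k t t' : bad k t -> bad k t' -> t = t'.
  move=> [M hM] [M' hM']; apply: contrapT => /eqP; rewrite -subr_eq0 -normr_gt0 => tt.
  (* Two bad values would give [|t - t'| |h| <= M + M'] on the whole ball, although [h] is unbounded
     there. *)
  have [z [zO zW]] := hU _ (W_boundary k).1 _ (W_boundary k).2 ((M + M') / `|t - t'|).
  rewrite ltr_pdivrMr// ltNge => /negP; apply.
  rewrite -[`|_|]cabs_real -cabsM.
  have -> : h z * (t - t')%:C = (f z + t%:C * h z) - (f z + t'%:C * h z).
    by rewrite rmorphB /=; ring.
  by apply: le_trans (cabsD _ _) _; rewrite cabsN lerD ?hM ?hM'.
have [t tI tN] : exists2 t, (`]0, t0[%classic : set R) t & forall k, ~ bad k t.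
  apply: contrapT => /forall2NP H.
  have cI : countable (`]0, t0[%classic : set R).
    (* [xget] selects the only bad value for [k], or 0 if there is none; if every [t] were bad, the
       interval would be countable and have measure 0. *)
    apply: (@sub_countable _ _ _ (range (fun k => xget 0 (bad k)))).
      apply: subset_card_le => t tI; have [/(_ tI)[]|/existsNP[k /contrapT tk]] := H t.
      by exists k => //; exact: bad1 (xgetPex 0 (ex_intro _ _ tk)) tk.
    exact: card_image_le.
  have := countable_lebesgue_measure0 cI; rewrite lebesgue_measure_itv/= lte_fin t0p.
  by rewrite oppr0 adde0 => -[] /eqP; rewrite gt_eqF.
move: tI; rewrite /= in_itv/= => /andP[tp tt0]; exists t; split => //.
apply/(totally_unboundedP _ Om_convex) => w bw d d0 M.
have [k _ sub] := W_base 0 bw d0.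
apply: contrapT => H; apply: (tN k); exists M => z zO zW.
rewrite leNgt; apply/negP => hM; apply: H; exists z; split => //; exact: sub.
Qed.

End TotallyUnbounded.

(** * Density and the G_delta property *)

Unset Implicit Arguments.

Theorem theorem14 (R : realType) (n : nat) (Om : set (cvec R n)) (q : \bar R)
  (ps : nat -> R) :
  copen Om -> cbounded Om -> cconvex Om -> (1%:E < q)%E -> exponent_seq q ps ->
  (* density *)
  (forall f, in_OLq_minus Om q f -> forall e : R, 0 < e ->
     exists g, [/\ in_OLq_minus Om q g, totally_unbounded Om g
                 & OL_dist Om ps f g < e]) /\
  (* G_delta: countable intersection of open subsets of the space *)
  (exists U : nat -> set (cvec R n -> R[i]),
     (forall k, U k `<=` in_OLq_minus Om q /\
        forall f, U k f -> exists2 r : R, 0 < r &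
          forall g, in_OLq_minus Om q g -> OL_dist Om ps f g < r -> U k g) /\
     [set g | in_OLq_minus Om q g /\ totally_unbounded Om g] = \bigcap_k U k).
Proof.
move=> oO bO cO _ hps.
(* Without boundary points, as for empty [Om], every function is totally unbounded vacuously;
   otherwise [w0] starts the construction of the balls. *)
have [[w0 bw0]|noB] := pselect (exists w, cboundary Om w); last first.
  have tu f : totally_unbounded Om f by move=> w bw; case: noB; exists w.
  split=> [f Xf e e0|].
    have [t0 t0p ht] := OL_dist_perturb oO hps Xf Xf e0.
    exists (fun z => f z + ((t0 / 2)%:C)%C * f z); split => //.
      exact: OLq_lin.
    by apply: ht; lra.
  exists (fun _ => in_OLq_minus Om q); split.
    by move=> k; split => // f _; exists 1.
  by apply/seteqP; split => [g [Xg _] k _|g Xg] //; split; [exact: (Xg 0%N)|].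
have [W [r [hW base]]] := boundary_base bw0; split.
  move=> f Xf e e0.
  have [h [hp hU]] := totally_unbounded_exists oO bO cO hW base.
  have Xh : in_OLq_minus Om q h by move=> p p1 _; exact: hp.
  have [t0 t0p ht] := OL_dist_perturb oO hps Xf Xh e0.
  have [t [tp tt0 tU]] := totally_unbounded_perturb cO hW base f hU t0p.
  by exists (fun z => f z + (t%:C)%C * h z); split; [exact: OLq_lin| |exact: ht].
(* The index [k] numbers both the ball and the level to exceed; this suffices because every
   neighbourhood of a boundary point contains balls of arbitrarily large index. *)
exists (fun k => [set g | in_OLq_minus Om q g /\
  exists z, [/\ Om z, cball (W k) (r k) z & k%:R < cabs (g z)]]); split.
  move=> k; split => [g []//|f [Xf [z [zO zW fz]]]].
  have [rho rho0 hrho] := exceed_open oO hps Xf zO zW fz.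
  by exists rho => // g Xg /(hrho g Xg).
apply/seteqP; split => [g [Xg /(totally_unboundedP _ cO) gU] k _|g gU].
  by split => //; exact: gU (hW k).1 _ (hW k).2 _.
split; first by have [] := gU 0%N I.
apply/(totally_unboundedP _ cO) => w bw d d0 M.
have [k Mk sub] := base w d (Num.bound `|M|) bw d0.
have [_ [z [zO zW gz]]] := gU k I; exists z; split => //; first exact: sub.
apply: lt_trans gz; apply: le_lt_trans (ler_norm M) _.
by apply: lt_le_trans (archi_boundP (normr_ge0 M)) _; rewrite ler_nat.
Qed.
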